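(* Let $t\ge 4$ be an integer. Then $s_{2,2}(K^{(3)}_t)=0$ and $s'_{2,2}(K^{(3)}_t)=(t-2)^2$.
   Context: A $3$-uniform hypergraph $H=(V,E)$ has $E\subseteq\binom{V}{3}$. $K^{(3)}_t$ is the complete $3$-uniform hypergraph on $t$ vertices. $H$ is $2$-Ramsey for $F$ if every coloring of $E(H)$ with $2$ colors contains a monochromatic copy of $F$; $H$ is minimal $2$-Ramsey for $F$ if it is $2$-Ramsey for $F$ but no proper subhypergraph is; $\mathcal{M}_2(F)$ denotes the set of minimal $2$-Ramsey $3$-uniform hypergraphs for $F$. For a $2$-set $S=\{u,v\}\subseteq V$, its codegree $\deg_G(S)$ is the number of edges containing $S$; $\delta_2(G)=\min_{S\in\binom{V(G)}{2}}\deg_G(S)$. Define $s_{2,2}(K^{(3)}_t)=\min_{G\in\mathcal{M}_2(K^{(3)}_t)}\delta_2(G)$ and \[ s'_{2,2}(K^{(3)}_t)=\min_{G\in\mathcal{M}_2(K^{(3)}_t)}\Bigl(\min\{\deg_G(S): S\in\tbinom{V(G)}{2},\ \deg_G(S)>0\}\Bigr). \] *)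

(* Defs.v *)
From mathcomp Require Import all_boot.

Set Implicit Arguments.
Unset Strict Implicit.
Unset Printing Implicit Defensive.

(* The vertex set is a subset of an ambient finite type, so that a
   subhypergraph may drop vertices as well as edges. *)
Record hypergraph3 (T : finType) := Hypergraph3 {
  verts : {set T};
  edges : {set {set T}};
  edgesP : [forall e in edges, (e \subset verts) && (#|e| == 3)]
}.

Definition subhypergraph (T : finType) (H' H : hypergraph3 T) : bool :=
  (verts H' \subset verts H) && (edges H' \subset edges H).

Definition proper_subhypergraph (T : finType) (H' H : hypergraph3 T) : Prop :=
  subhypergraph H' H /\ H' <> H.

Lemma complete3_subproof (t : nat) :
  [forall e in [set e : {set 'I_t} | #|e| == 3],
     (e \subset [set: 'I_t]) && (#|e| == 3)].
Proof. by apply/forall_inP => e; rewrite inE subsetT. Qed.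

Definition complete3 (t : nat) : hypergraph3 'I_t :=
  Hypergraph3 (complete3_subproof t).

(* [c] is defined on all sets of vertices; only its values on the edges
   of [H] matter. *)
Definition monochromatic_copy (r : nat) (U T : finType)
    (F : hypergraph3 U) (H : hypergraph3 T) (c : {set T} -> 'I_r) : Prop :=
  exists (f : U -> T) (i : 'I_r),
    [/\ {in verts F &, injective f},
        f @: verts F \subset verts H &
        forall e : {set U}, e \in edges F ->
          f @: e \in edges H /\ c (f @: e) = i].

Definition ramsey (r : nat) (U T : finType)
    (F : hypergraph3 U) (H : hypergraph3 T) : Prop :=
  forall c : {set T} -> 'I_r, monochromatic_copy F H c.

Definition minimal_ramsey (r : nat) (U T : finType)
    (F : hypergraph3 U) (H : hypergraph3 T) : Prop :=
  ramsey r F H /\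
  forall H' : hypergraph3 T, proper_subhypergraph H' H -> ~ ramsey r F H'.

Definition codegree (T : finType) (H : hypergraph3 T) (S : {set T}) : nat :=
  #|[set e in edges H | S \subset e]|.

(* Minima are relations rather than functions, so that no default value is
   needed: [is_min P m] includes that the minimum is attained. *)
Definition is_min (P : nat -> Prop) (m : nat) : Prop :=
  P m /\ forall k, P k -> m <= k.

Definition is_delta2 (T : finType) (H : hypergraph3 T) (d : nat) : Prop :=
  is_min (fun k => exists S : {set T},
    [/\ S \subset verts H, #|S| = 2 & codegree H S = k]) d.

Definition is_pos_delta2 (T : finType) (H : hypergraph3 T) (d : nat) : Prop :=
  is_min (fun k => exists S : {set T},
    [/\ S \subset verts H, #|S| = 2, 0 < codegree H S & codegree H S = k]) d.

Definition is_s22 (t s : nat) : Prop :=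
  is_min (fun d => exists (T : finType) (H : hypergraph3 T),
    minimal_ramsey 2 (complete3 t) H /\ is_delta2 H d) s.

Definition is_s22' (t s : nat) : Prop :=
  is_min (fun d => exists (T : finType) (H : hypergraph3 T),
    minimal_ramsey 2 (complete3 t) H /\ is_pos_delta2 H d) s.

(* Main.v *)
Require Import Defs.
From mathcomp Require Import all_boot.
From Stdlib Require Import Classical.

Set Implicit Arguments.
Unset Strict Implicit.
Unset Printing Implicit Defensive.

(** Put [s = t - 2].  Lower bound: if [S] has positive codegree less than
    [s ^ 2] in a minimal Ramsey hypergraph, colour the edges not containing [S]
    without monochromatic clique; in the link of [S] take a maximal disjoint
    family of at most [s - 1] [s]-sets forming red cliques with both vertices of
    [S].  Making the edges from [S] to that family blue and the other edges at
    [S] red creates no monochromatic clique, since a blue [s]-set meets each red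
    one in at most one vertex.

    Upper bound: on two apexes [u], [v] and an [s * s] grid, let the row triples
    be red and the transversal triples blue.  Then no colouring of the [s ^ 2]
    triples [u v w] avoids a monochromatic clique: either some row is
    completely red or a transversal is completely blue.  To force this
    colouring, every transversal triple is completed to a [t]-clique with new
    vertices; if the row triples and the new triples are red, the transversal
    triples have to be blue.  The red part is clique-free, so the partite
    construction of Nesetril and Rodl (with the Hales-Jewett theorem as partite
    lemma) gives a clique-free hypergraph each of whose colourings contains a
    monochromatic copy of it, and adding the remaining triples of all copies
    yields a Ramsey hypergraph.  Applying the construction twice makes the two
    apexes determine the copy, so the pair they form has codegree [s ^ 2].
    Finally, pairwise covered sets of more than three vertices lie in a
    single copy, and a copy is not Ramsey; hence a minimal Ramsey
    subhypergraph has an uncovered pair. *)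

(** * The Hales-Jewett theorem and Ramsey's theorem *)

(** A combinatorial line is encoded as a word over [option T]: [None] marks its moving coordinates,
    and [fill l a] is its point at the letter [a]. *)
Definition fill (I T : finType) (l : {ffun I -> option T}) (a : T) :
  {ffun I -> T} := [ffun i => odflt a (l i)].

Definition moving (I T : finType) (l : {ffun I -> option T}) : bool :=
  [exists i, l i == None].

Definition juxt (I1 I2 T : finType) (f : {ffun I1 -> T}) (g : {ffun I2 -> T}) :
  {ffun I1 + I2 -> T} :=
  [ffun i => match i with inl i1 => f i1 | inr i2 => g i2 end].

Lemma fill_juxt (I1 I2 T : finType) (l1 : {ffun I1 -> option T})
    (l2 : {ffun I2 -> option T}) (a : T) :
  fill (juxt l1 l2) a = juxt (fill l1 a) (fill l2 a).
Proof. by apply/ffunP => -[i|i]; rewrite !ffunE. Qed.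

Lemma fill_const (I T : finType) (w : {ffun I -> T}) (a : T) :
  fill [ffun i => Some (w i)] a = w.
Proof. by apply/ffunP => i; rewrite !ffunE. Qed.

Lemma moving_juxtl (I1 I2 T : finType) (l1 : {ffun I1 -> option T})
    (l2 : {ffun I2 -> option T}) : moving l1 -> moving (juxt l1 l2).
Proof. by case/existsP=> i li; apply/existsP; exists (inl i); rewrite ffunE. Qed.

Lemma moving_juxtr (I1 I2 T : finType) (l1 : {ffun I1 -> option T})
    (l2 : {ffun I2 -> option T}) : moving l2 -> moving (juxt l1 l2).
Proof. by case/existsP=> i li; apply/existsP; exists (inr i); rewrite ffunE. Qed.

Lemma moving_diag (T : finType) :
  moving [ffun _ : unit => @None T].
Proof. by apply/existsP; exists tt; rewrite ffunE. Qed.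

(* Colour focusing: the lines collected in [G] have pairwise distinct colours
   on [A] and meet at the letter [b]; the colour of the meeting word either
   closes one of these lines or contributes a new colour. *)
Lemma color_focusing (T : finType) (a0 b : T) (A : seq T) :
  a0 \in A ->
  (forall C : finType, exists I : finType, forall c : {ffun I -> T} -> C,
     exists2 l, moving l & {in A &, forall a a', c (fill l a) = c (fill l a')}) ->
  forall (C : finType) (m : nat), exists I : finType,
  forall c : {ffun I -> T} -> C,
    (exists2 l, moving l &
       {in b :: A &, forall a a', c (fill l a) = c (fill l a')}) \/
    exists (w : {ffun I -> T}) (G : {set C}), m <= #|G| /\
      forall x, x \in G -> exists2 l, moving l &
        fill l b = w /\ {in A, forall a, c (fill l a) = x}.
Proof.
move=> a0A IH C; elim=> [|m [I2 IHm]].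
  exists unit => c; right; exists [ffun=> b], set0; split=> // x.
  by rewrite inE.
(* A word of the first block is coloured by the whole colouring it induces on the second block. On
   [l1] the letters of [A] are therefore indistinguishable, whatever word follows. *)
have [I1 HI1] := IH {ffun {ffun I2 -> T} -> C}.
exists (I1 + I2)%type => c.
have [l1 ml1 Hl1] := HI1 (fun u => [ffun v => c (juxt u v)]).
have c1 a v : a \in A -> c (juxt (fill l1 a) v) = c (juxt (fill l1 a0) v).
  by move=> aA; have /ffunP/(_ v) := Hl1 a a0 aA a0A; rewrite !ffunE.
have [[l2 ml2 Hl2]|[w [G [mG HG]]]] := IHm (fun v => c (juxt (fill l1 a0) v)).
  left; exists (juxt [ffun i => Some (fill l1 a0 i)] l2).
    exact: moving_juxtr.
  by move=> a a' aA a'A; rewrite !fill_juxt !fill_const; apply: Hl2.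
(* If the meeting word has the colour of a line already focused on it, that line stays monochromatic
   at the letter [b]. *)
have [cG|cG] := boolP (c (juxt (fill l1 a0) w) \in G).
  have [l ml [lb lA]] := HG _ cG.
  left; exists (juxt [ffun i => Some (fill l1 a0 i)] l).
    exact: moving_juxtr.
  have E a : a \in b :: A ->
      c (juxt (fill l1 a0) (fill l a)) = c (juxt (fill l1 a0) w).
    by rewrite inE => /orP[/eqP->|/lA //]; rewrite lb.
  by move=> a a' aA a'A; rewrite !fill_juxt !fill_const !E.
(* Otherwise the colour is new: its line moves in the first block only, the old lines now move in
   both blocks, and all of them meet at the letter [b]. *)
right; exists (juxt (fill l1 b) w), (c (juxt (fill l1 a0) w) |: G); split.
  by rewrite cardsU1 cG.
move=> x /setU1P[->|/HG[l ml [lb lA]]].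
  exists (juxt l1 [ffun i => Some (w i)]); first exact: moving_juxtl.
  by split=> [|a aA]; rewrite fill_juxt fill_const // c1.
exists (juxt l1 l); first exact: moving_juxtl.
by split=> [|a aA]; rewrite fill_juxt ?lb // c1 // lA.
Qed.

Lemma hales_jewett_in (T : finType) (A : seq T) (C : finType) :
  exists I : finType, forall c : {ffun I -> T} -> C,
    exists2 l, moving l & {in A &, forall a a', c (fill l a) = c (fill l a')}.
Proof.
elim: A C => [|b A IH] C.
  by exists unit => c; exists [ffun=> None]; first exact: moving_diag.
case: A IH => [|a0 A] IH.
  exists unit => c; exists [ffun=> None]; first exact: moving_diag.
  by move=> a a'; rewrite !inE => /eqP-> /eqP->.
have a0A : a0 \in a0 :: A by rewrite mem_head.
(* With one more colour demanded than [C] has, only the alternative of a monochromatic line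
   survives. *)
have [I HI] := color_focusing b a0A IH C #|C|.+1.
exists I => c; have [//|[w [G [mG _]]]] := HI c.
by move: (max_card (mem G)); rewrite leqNgt mG.
Qed.

Lemma hales_jewett (T C : finType) :
  exists I : finType, forall c : {ffun I -> T} -> C,
    exists2 l, moving l & forall a a', c (fill l a) = c (fill l a').
Proof.
have [I HI] := hales_jewett_in (enum T) C; exists I => c.
by have [l ml lP] := HI c; exists l => // a a'; apply: lP; rewrite mem_enum.
Qed.

(** Double induction on the two sizes. A removed vertex [x] colours the [k]-sets by [c (x |: Y)].
    Inside a set [X] on which this colour is constantly [b], one vertex less is demanded in colour
    [b], and adding [x] makes up for it. *)
Lemma ramsey_sets_asym (k : nat) :
  (forall m, exists N, forall (V : finType) (A : {set V}) (c : {set V} -> bool),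
    N <= #|A| -> exists (X : {set V}) (b : bool), [/\ X \subset A, #|X| = m &
      forall Y : {set V}, Y \subset X -> #|Y| = k -> c Y = b]) ->
  forall m0 m1, exists N, forall (V : finType) (A : {set V}) (c : {set V} -> bool),
    N <= #|A| -> exists (X : {set V}) (b : bool),
      [/\ X \subset A, #|X| = (if b then m1 else m0) &
        forall Y : {set V}, Y \subset X -> #|Y| = k.+1 -> c Y = b].
Proof.
move=> IH; elim=> [|m0 IH0].
  move=> m1; exists 0 => V A c _; exists set0, false.
  rewrite sub0set cards0; split=> // Y; rewrite subset0 => /eqP->.
  by rewrite cards0.
elim=> [|m1 [N1 IH1]].
  exists 0 => V A c _; exists set0, true.
  rewrite sub0set cards0; split=> // Y; rewrite subset0 => /eqP->.
  by rewrite cards0.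
have [N0 {}IH0] := IH0 m1.+1; have [N HN] := IH (maxn N0 N1).
exists N.+1 => V A c NA.
have [x xA] : exists x, x \in A by apply/card_gt0P; apply: leq_trans NA.
have [|X [b [XA cX HX]]] := HN V (A :\ x) (fun Y => c (x |: Y)).
  by move: NA; rewrite (cardsD1 x) xA.
have xX : x \notin X by apply/negP=> /(subsetP XA); rewrite !inE eqxx.
have XA' : X \subset A by apply: subset_trans XA (subsetDl _ _).
have ext (Z : {set V}) : Z \subset X ->
    (forall Y : {set V}, Y \subset Z -> #|Y| = k.+1 -> c Y = b) ->
    forall Y : {set V}, Y \subset x |: Z -> #|Y| = k.+1 -> c Y = b.
  move=> ZX HZ Y YZ cY; have [xY|xY] := boolP (x \in Y); last first.
    apply: HZ => //; apply/subsetP=> y yY; move: (subsetP YZ y yY).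
    by rewrite !inE; case: eqP => // yx; rewrite -yx yY in xY.
  rewrite -(setD1K xY); apply: HX.
    by apply: subset_trans ZX; rewrite subDset.
  by move: cY; rewrite (cardsD1 x) xY => -[].
have fin (Z : {set V}) : Z \subset X ->
   (forall Y : {set V}, Y \subset Z -> #|Y| = k.+1 -> c Y = b) ->
   #|Z|.+1 = (if b then m1.+1 else m0.+1) ->
   exists (X : {set V}) (b : bool),
      [/\ X \subset A, #|X| = (if b then m1.+1 else m0.+1) &
        forall Y : {set V}, Y \subset X -> #|Y| = k.+1 -> c Y = b].
  move=> ZX HZ cZ; exists (x |: Z), b; split; last exact: ext.
    by rewrite subUset sub1set xA (subset_trans ZX).
  by rewrite cardsU1 (contra (subsetP ZX x)).
case: b {HX} ext fin => ext fin.
  have [|Z [b [ZX cZ HZ]]] := IH1 V X c; first by rewrite cX leq_maxr.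
  case: b cZ HZ => cZ HZ; first by apply: (fin Z) => //; rewrite cZ.
  by exists Z, false; rewrite (subset_trans ZX).
have [|Z [b [ZX cZ HZ]]] := IH0 V X c; first by rewrite cX leq_maxl.
case: b cZ HZ => cZ HZ; last by apply: (fin Z) => //; rewrite cZ.
by exists Z, true; rewrite (subset_trans ZX).
Qed.

Lemma subset_of_card (V : finType) (A : {set V}) (m : nat) :
  m <= #|A| -> exists2 X : {set V}, X \subset A & #|X| = m.
Proof.
elim: m => [_|m IH mA]; first by exists set0; rewrite ?sub0set ?cards0.
have [X XA cX] := IH (ltnW mA).
have /set0Pn[x] : A :\: X != set0.
  by rewrite -card_gt0 cardsDS // subn_gt0 cX.
rewrite inE => /andP[xX xA]; exists (x |: X); last by rewrite cardsU1 xX cX.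
by rewrite subUset sub1set xA.
Qed.

Lemma ramsey_sets (k m : nat) :
  exists N, forall (V : finType) (A : {set V}) (c : {set V} -> bool),
    N <= #|A| -> exists (X : {set V}) (b : bool), [/\ X \subset A, #|X| = m &
      forall Y : {set V}, Y \subset X -> #|Y| = k -> c Y = b].
Proof.
elim: k m => [|k IH] m.
  exists m => V A c /subset_of_card[X XA cX]; exists X, (c set0); split=> // Y _.
  by move/eqP; rewrite cards_eq0 => /eqP->.
have [N HN] := ramsey_sets_asym IH m m.
exists N => V A c /(HN V A c)[X [b [XA cX HX]]]; exists X, b; split=> //.
by case: b cX {HX}.
Qed.

(** * The partite construction *)

Definition covered (V : finType) (E : {set {set V}}) (A : {set V}) : bool :=
  [exists e in E, A \subset e].

Lemma coveredP (V : finType) (E : {set {set V}}) (A : {set V}) :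
  reflect (exists2 e, e \in E & A \subset e) (covered E A).
Proof. exact: exists_inP. Qed.

Section Partite.

Variables (J : finType) (EJ XJ : {set {set J}}).

Definition ramsey_family (W : finType) (E : {set {set W}})
    (F : {set {ffun J -> W}}) : Prop :=
  [/\ forall e, e \in E -> #|e| = 3,
      forall f : {ffun J -> W}, f \in F ->
        injective f /\ forall e, e \in EJ -> f @: e \in E &
      forall c : {set W} -> bool, exists2 f : {ffun J -> W}, f \in F &
        exists b, forall e, e \in EJ -> c (f @: e) = b].

(** The sets of [XJ] are transported by the copies, but the Ramsey property concerns [EJ] only. They
    are the edges whose colours the gadget is to force. *)
Definition extras (V : finType) (F : {set {ffun J -> V}}) : {set {set V}} :=
  [set y.1 @: y.2 | y : {ffun J -> V} * {set J} in setX F XJ].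

Lemma extrasP (V : finType) (F : {set {ffun J -> V}}) (h : {set V}) :
  reflect (exists (f : {ffun J -> V}) (x : {set J}), [/\ f \in F, x \in XJ & h = f @: x])
    (h \in extras F).
Proof.
apply: (iffP imsetP) => [[[f x]]|[f [x [fF xX ->]]]].
  by rewrite inE /= => /andP[fF xX] ->; exists f, x.
by exists (f, x); rewrite // inE fF.
Qed.

(* [p] assigns to each vertex its part, an element of the vertex set of the
   base [EW]; the colouring has been made to depend on the part of an edge
   only for the edges above [D]. *)
Record partite_stage (W : finType) (EW : {set {set W}})
    (FW : {set {ffun J -> W}}) (D : {set {set W}})
    (V : finType) (p : V -> W) (E : {set {set V}})
    (F : {set {ffun J -> V}}) : Prop := PartiteStage {
  stage_inj : forall e, e \in E -> {in e &, injective p};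
  stage_proj : forall e, e \in E -> p @: e \in EW;
  stage_copy : forall f : {ffun J -> V}, f \in F -> [ffun x => p (f x)] \in FW;
  stage_edge : forall f : {ffun J -> V}, f \in F ->
    forall e, e \in EJ -> f @: e \in E;
  stage_induced : forall f : {ffun J -> V}, f \in F ->
    forall A : {set J}, covered E (f @: A) -> covered EJ A;
  stage_coherent : forall f g : {ffun J -> V}, f \in F -> g \in F ->
    forall A B : {set J}, f @: A = g @: B ->
    A = B \/ covered EJ A /\ covered EJ B;
  stage_local : forall Q : {set V}, 3 < #|Q| ->
    {in Q &, forall x y, x != y -> covered (E :|: extras F) [set x; y]} ->
    exists2 f : {ffun J -> V}, f \in F & Q \subset f @: setT;
  stage_determined : forall f g : {ffun J -> V}, f \in F -> g \in F ->
    forall u v, ~~ covered EW [set p (f u); p (f v)] ->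
    f @: [set u; v] = g @: [set u; v] -> f = g;
  stage_ramsey : forall c : {set V} -> bool,
    (exists chi : {set W} -> bool,
      forall e, e \in E -> p @: e \notin D -> c e = chi (p @: e)) ->
    exists2 f : {ffun J -> V}, f \in F &
      exists b, forall e, e \in EJ -> c (f @: e) = b }.

(** * The initial stage: disjoint copies *)

Section Initial.

Variables (W : finType) (EW : {set {set W}}) (FW : {set {ffun J -> W}}).
Hypothesis ramW : ramsey_family EW FW.

Let V0 : finType := ({ffun J -> W} * J)%type.
Let p0 (v : V0) : W := v.1 v.2.
Let tag (f : {ffun J -> W}) : {ffun J -> V0} := [ffun x => (f, x)].
Let E0 : {set {set V0}} := [set tag y.1 @: y.2 | y : {ffun J -> W} * {set J} in setX FW EJ].
Let F0 : {set {ffun J -> V0}} := [set tag f | f in FW].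

Let tag_inj f : injective (tag f).
Proof. by move=> x y; rewrite !ffunE => -[]. Qed.

Let E0P h : reflect (exists f (e : {set J}), [/\ f \in FW, e \in EJ & h = tag f @: e]) (h \in E0).
Proof.
apply: (iffP imsetP) => [[[f x]]|[f [x [fF xX ->]]]].
  by rewrite inE /= => /andP[fF xX] ->; exists f, x.
by exists (f, x); rewrite // inE fF.
Qed.

Let proj_tag f : [ffun x => p0 (tag f x)] = f.
Proof. by apply/ffunP => x; rewrite !ffunE. Qed.

Let tag_sub f g (A B : {set J}) x :
  x \in A -> tag f @: A \subset tag g @: B -> f = g /\ A \subset B.
Proof.
move=> xA AB.
have fg : f = g.
  have /imsetP[y _] := subsetP AB _ (imset_f (tag f) xA).
  by rewrite !ffunE => -[].
split=> //; apply/subsetP=> y yA.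
have /imsetP[z zB] := subsetP AB _ (imset_f (tag f) yA).
by rewrite !ffunE => -[_ ->].
Qed.

(** Each copy in [FW] receives its own vertices, tagged by the copy itself. As [D] is empty, the
    colour of an edge depends only on its projection, so the Ramsey property of [FW] applies. *)
Lemma initial_stage :
  0 < #|EJ| ->
  exists (V : finType) (p : V -> W) (E : {set {set V}}) (F : {set {ffun J -> V}}),
    partite_stage EW FW set0 p E F.
Proof.
move=> /card_gt0P[e0 e0J].
have [card3 copies ram] := ramW.
have cov0 A : A = set0 -> covered EJ A.
  by move=> ->; apply/coveredP; exists e0; rewrite ?sub0set.
exists V0, p0, E0, F0; split.
- move=> _ /E0P[f [e [fF eJ ->]]] _ _ /imsetP[x xe ->] /imsetP[y ye ->].
  by rewrite !ffunE /p0 /= => /(proj1 (copies f fF)) ->.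
- move=> _ /E0P[f [e [fF eJ ->]]]; rewrite -imset_comp.
  rewrite (eq_imset (g := f)); first exact: (proj2 (copies f fF)).
  by move=> x /=; rewrite ffunE.
- by move=> _ /imsetP[f fF ->]; rewrite proj_tag.
- move=> _ /imsetP[f fF ->] e eJ; apply/E0P; by exists f, e.
- move=> _ /imsetP[f fF ->] A; have [/cov0//|[x xA]] := set_0Vmem A.
  case/coveredP=> _ /E0P[g [e [gF eJ ->]]] /(tag_sub xA)[_ Ae].
  by apply/coveredP; exists e.
- move=> _ _ /imsetP[f fF ->] /imsetP[g gF ->] A B AB.
  have [A0|[x xA]] := set_0Vmem A.
    left; move: AB; rewrite A0 imset0 => /esym/eqP.
    by rewrite imset_eq0 => /eqP->.
  have [] := @tag_sub f g A B x xA; first by rewrite AB.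
  by move=> fg _; left; move: AB; rewrite fg => /(imset_inj (@tag_inj g)).
- move=> Q cQ covQ.
  have [x xQ] : exists x, x \in Q by apply/card_gt0P; apply: leq_trans cQ.
  have Qx y : y \in Q -> x != y -> x.1 \in FW /\ y.1 = x.1.
    move=> yQ xy; have /coveredP[h hE] := covQ x y xQ yQ xy.
    rewrite subUset !sub1set => /andP[].
    have [f [A [fF ->]]] : exists f (A : {set J}), f \in FW /\ h = tag f @: A.
      case/setUP: hE => [/E0P[f [e [fF _ ->]]]|]; first by exists f, e.
      by case/extrasP=> _ [A [/imsetP[f fF ->] _ ->]]; exists f, A.
    by move=> /imsetP[a _ ->] /imsetP[b _ ->]; rewrite !ffunE.
  have [y] : exists y, y \in Q :\ x.
    by apply/card_gt0P; move: cQ; rewrite (cardsD1 x) xQ; case: #|_|.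
  rewrite !inE eq_sym => /andP[xy yQ].
  have [xF _] := Qx y yQ xy.
  exists (tag x.1); first exact: imset_f.
  apply/subsetP=> z zQ; apply/imsetP; exists z.2 => //; rewrite ffunE.
  have [->|xz] := eqVneq x z; first by case: (z).
  by rewrite -(proj2 (Qx z zQ xz)); case: (z).
- move=> _ _ /imsetP[f fF ->] /imsetP[g gF ->] u v _ fg.
  by have [] := @tag_sub f g [set u; v] [set u; v] u; rewrite ?fg ?set21 // => ->.
- move=> c [chi chiP]; have [f fF [b bP]] := ram chi.
  exists (tag f); first exact: imset_f.
  exists b => e eJ; rewrite -(bP e eJ) chiP ?inE //.
    congr chi; rewrite -imset_comp; apply: eq_imset => x /=.
    by rewrite ffunE.
  by apply/E0P; exists f, e.
Qed.

End Initial.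

(** * Amalgamation along one edge of the base *)

Section Amalgamation.

Variables (W : finType) (EW : {set {set W}}) (FW : {set {ffun J -> W}}).
Hypothesis ramW : ramsey_family EW FW.
Variables (D : {set {set W}}) (V : finType) (p : V -> W) (E : {set {set V}})
  (F : {set {ffun J -> V}}).
Hypothesis st : partite_stage EW FW D p E F.
Variable d : {set W}.
Hypothesis dW : d \in EW.

(** The edges above [d] are the letters of the Hales-Jewett words. *)
Let T : finType := {e : {set V} | (e \in E) && (p @: e == d)}.
Variables (I : finType) (i0 : I).
Hypothesis HJ : forall c : {ffun I -> T} -> bool,
  exists2 l, moving l & forall a a', c (fill l a) = c (fill l a').

Implicit Types (l : {ffun I -> option T}) (w : {ffun I -> T}) (i : I) (x : V).

(** There is one copy of the stage per line, and copies are glued only above [d]: a vertex outside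
    the parts of [d] carries its line as a tag, while a vertex above [d] becomes a tuple of vertices
    indexed by [I]. *)
Let V1 : finType := (({ffun I -> option T} * V) + {ffun I -> V})%type.

(* The vertex of the edge [e] lying in the part of [x]. *)
Let sel (e : {set V}) (x : V) : V := odflt x [pick z in e | p z == p x].

(** The embedding of the copy along [l]. Above [d], moving coordinates keep [x] and a fixed letter
    [e] contributes its vertex in the part of [x]. All coordinates then share one part, which [p1]
    reads off at [i0]. *)
Let psi (l : {ffun I -> option T}) (x : V) : V1 :=
  if p x \in d then inr [ffun i => if l i is Some e then sel (val e) x else x]
  else inl (l, x).

Let p1 (v : V1) : W := match v with inl q => p q.2 | inr f => p (f i0) end.

Let word_edge (w : {ffun I -> T}) : {set V1} :=
  [set v : V1 | if v is inr f then
     [forall i, (f i \in val (w i)) && (p (f i) == p (f i0))] else false].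

Let E1 : {set {set V1}} :=
  [set word_edge w | w : {ffun I -> T}] :|:
  [set psi y.1 @: y.2 | y : {ffun I -> option T} * {set V} in
     setX [set l | moving l] E].

Let F1 : {set {ffun J -> V1}} :=
  [set [ffun x : J => psi y.1 (y.2 x)] |
     y : {ffun I -> option T} * {ffun J -> V} in setX [set l | moving l] F].

Let coord i (v : V1) : V := match v with inl q => q.2 | inr f => f i end.

Let TP (e : T) : val e \in E /\ p @: val e = d.
Proof. by have /andP[? /eqP] := valP e. Qed.

Let selP (e : T) x : p x \in d -> sel (val e) x \in val e /\ p (sel (val e) x) = p x.
Proof.
have [_ pe] := TP e => pxd.
have /imsetP[z ze pz] : p x \in p @: val e by rewrite pe.
rewrite /sel.
by case: pickP => [y /andP[ye /eqP]|/(_ z)] //=; rewrite ze pz eqxx.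
Qed.

Let p_psi l x : p1 (psi l x) = p x.
Proof.
rewrite /psi; case: ifP => [px|] //=; rewrite ffunE.
by case: (l i0) => // e; case: (selP e px).
Qed.

Let coord_none l i x : l i = None -> coord i (psi l x) = x.
Proof. by move=> li; rewrite /psi; case: ifP => //= _; rewrite ffunE li. Qed.

Let coord_some l i x (e : T) :
  l i = Some e -> p x \in d -> coord i (psi l x) \in val e.
Proof. by move=> li px; rewrite /psi px /= ffunE li; case: (selP e px). Qed.

Let psi_inj l : moving l -> injective (psi l).
Proof.
by case/existsP=> i /eqP li x y /(congr1 (coord i)); rewrite !coord_none.
Qed.

Let psi_same l l' x y : psi l x = psi l' y -> p x \notin d -> l = l' /\ x = y.
Proof.
move=> xy pxd; have pyd : p y \notin d by rewrite -(p_psi l') -xy p_psi.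
by move: xy; rewrite /psi (negPf pxd) (negPf pyd) => -[].
Qed.

Let coord_psi (l : {ffun I -> option T}) i (A : {set V}) :
  l i = None -> coord i @: (psi l @: A) = A.
Proof.
move=> li; rewrite -imset_comp -[RHS]imset_id.
by apply: eq_imset => x /=; rewrite coord_none.
Qed.

Let p_psi_set l (A : {set V}) : p1 @: (psi l @: A) = p @: A.
Proof. by rewrite -imset_comp; apply: eq_imset => x /=; rewrite p_psi. Qed.

(** A vertex outside [d] reveals the line, and then injectivity of [psi l] gives equality. If
    everything lies above [d], read a moving coordinate of one line: if it also moves in the other
    line, the sets agree; if it carries a fixed letter there, the set lies inside that edge. *)
Let psi_coherent l l' (A B : {set V}) : moving l -> moving l' ->
  psi l @: A = psi l' @: B -> A = B \/ covered E A /\ covered E B.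
Proof.
move=> ml ml' AB.
have half k k' (A' B' : {set V}) : moving k ->
    psi k @: A' = psi k' @: B' -> p @: B' \subset d ->
    A' = B' \/ covered E A'.
  move=> /existsP[i /eqP ki] AB' Bd.
  have A'E : A' = coord i @: (psi k' @: B') by rewrite -AB' coord_psi.
  case k'i: (k' i) => [e|]; last by left; rewrite A'E coord_psi.
  right; apply/coveredP; exists (val e); first by case: (TP e).
  rewrite A'E -imset_comp; apply/subsetP=> _ /imsetP[x xB ->].
  by apply: coord_some k'i _; apply: (subsetP Bd); apply: imset_f.
have pAB : p @: A = p @: B by rewrite -(p_psi_set l) AB p_psi_set.
have [Ad|] := boolP (p @: A \subset d).
  have Bd : p @: B \subset d by rewrite -pAB.
  have [->|cA] := half l l' A B ml AB Bd; first by left.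
  by have [->|cB] := half l' l B A ml' (esym AB) Ad; [left|right].
case/subsetPn=> _ /imsetP[x xA ->] pxd; left.
have /imsetP[y yB xy] : psi l x \in psi l' @: B by rewrite -AB imset_f.
have [ll _] := psi_same xy pxd; rewrite -ll in AB.
exact: imset_inj (psi_inj ml) _ _ AB.
Qed.

(** The link with Hales-Jewett: the images of the edges above [d] in the copy along [l] are the
    edges of the words on the line [l]. *)
Let psi_word_edge l (e : T) : psi l @: val e = word_edge (fill l e).
Proof.
have fillE i : fill l e i = if l i is Some e' then e' else e.
  by rewrite ffunE; case: (l i).
have pd x : x \in val e -> p x \in d.
  by have [_ pe] := TP e => xe; rewrite -pe imset_f.
apply/setP=> v; apply/imsetP/idP => [[x xe ->]|].
  rewrite inE /psi pd //; apply/forallP=> i; rewrite fillE !ffunE.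
  have pf j : p (if l j is Some e' then sel (val e') x else x) = p x.
    by case: (l j) => // e'; case: (selP e' (pd x xe)).
  by rewrite !pf eqxx andbT; case: (l i) => // e'; case: (selP e' (pd x xe)).
case: v => [q|f]; rewrite inE // => /forallP fP.
have f_in i : f i \in val (fill l e i) by case/andP: (fP i).
have pf i : p (f i) = p (f i0) by case/andP: (fP i) => _ /eqP.
have [x xe px] : exists2 x, x \in val e & p (f i0) = p x.
  apply/imsetP; have [_ ->] := TP e; have [_ <-] := TP (fill l e i0).
  exact: imset_f.
exists x => //; rewrite /psi pd //; congr inr; apply/ffunP => i; rewrite ffunE.
have := f_in i; rewrite fillE; case: (l i) => [e'|] fi.
  have [se' pe'] := selP e' (pd x xe).
  by have [e'E _] := TP e'; apply: (stage_inj st e'E); rewrite ?pe' ?pf.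
by have [eE _] := TP e; apply: (stage_inj st eE); rewrite ?pf.
Qed.

Let E1P h : h \in E1 -> (exists w, h = word_edge w) \/
  exists l (e : {set V}), [/\ moving l, e \in E & h = psi l @: e].
Proof.
case/setUP=> /imsetP[w]; first by move=> _ ->; left; exists w.
by rewrite !inE => /andP[mw wE] ->; right; exists w.1, w.2.
Qed.

Let E1_psi l (e : {set V}) : moving l -> e \in E -> psi l @: e \in E1.
Proof.
move=> ml eE; apply/setUP; right; apply/imsetP; exists (l, e) => //.
by rewrite !inE ml.
Qed.

Let F1P g : reflect (exists l (f : {ffun J -> V}),
    [/\ moving l, f \in F & g = [ffun x : J => psi l (f x)]]) (g \in F1).
Proof.
apply: (iffP imsetP) => [[[l f]]|[l [f [ml fF ->]]]].
  by rewrite !inE /= => /andP[ml fF] ->; exists l, f.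
by exists (l, f); rewrite // !inE ml.
Qed.

Let comp_imset l (f : {ffun J -> V}) (A : {set J}) :
  [ffun x : J => psi l (f x)] @: A = psi l @: (f @: A).
Proof. by rewrite -imset_comp; apply: eq_imset => x; rewrite ffunE. Qed.

Let all1P h : h \in E1 :|: extras F1 -> (exists w, h = word_edge w) \/
  exists l (e : {set V}), [/\ moving l, e \in E :|: extras F & h = psi l @: e].
Proof.
case/setUP=> [/E1P[|[l [e [ml eE ->]]]]|]; first by left.
  by right; exists l, e; rewrite inE eE.
case/extrasP=> _ [x [/F1P[l [f [ml fF ->]]] xX ->]]; right.
exists l, (f @: x); rewrite comp_imset; split=> //.
by apply/setUP; right; apply/extrasP; exists f, x.
Qed.

Let word_edge_inside v w : v \in word_edge w -> p1 v \in d.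
Proof.
case: v => [q|f]; rewrite inE // => /forallP/(_ i0)/andP[fi _] /=.
by have [_ <-] := TP (w i0); apply: imset_f.
Qed.

Let psi_word_covered l (A : {set V}) w :
  moving l -> psi l @: A \subset word_edge w -> covered E A.
Proof.
case/existsP=> i /eqP li Aw; apply/coveredP; exists (val (w i)).
  by case: (TP (w i)).
apply/subsetP=> x xA; have := subsetP Aw _ (imset_f (psi l) xA).
rewrite inE; case Ev: (psi l x) => [//|f] /forallP/(_ i)/andP[fi _].
by have := coord_none x li; rewrite Ev /= => <-.
Qed.

Let psi_sub l l' (A B : {set V}) : moving l -> moving l' ->
  psi l @: A \subset psi l' @: B -> A \subset B \/ covered E A.
Proof.
move=> ml ml' AB.
have AB' : psi l @: A = psi l' @: [set y in B | psi l' y \in psi l @: A].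
  apply/setP=> v; apply/idP/imsetP => [vA|[y]].
    have /imsetP[y yB vy] := subsetP AB v vA.
    by exists y => //; rewrite inE yB -vy.
  by rewrite inE => /andP[_ ?] ->.
have [->|[cA _]] := psi_coherent ml ml' AB'; last by right.
by left; apply/subsetP=> x; rewrite inE => /andP[].
Qed.

Let psi_induced l (A : {set V}) :
  moving l -> covered E1 (psi l @: A) -> covered E A.
Proof.
move=> ml /coveredP[h /E1P[[w ->]|[l' [e [ml' eE ->]]]]].
  exact: psi_word_covered.
by case/psi_sub=> // Ae; apply/coveredP; exists e.
Qed.

Let psi_induced_all l (A : {set V}) : moving l ->
  covered (E1 :|: extras F1) (psi l @: A) -> covered (E :|: extras F) A.
Proof.
have sub : covered E A -> covered (E :|: extras F) A.
  by case/coveredP=> e eE Ae; apply/coveredP; exists e; rewrite // inE eE.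
move=> ml /coveredP[h /all1P[[w ->]|[l' [e [ml' eE ->]]]]].
  by move/psi_word_covered/sub; apply.
by case/psi_sub=> // Ae; apply/coveredP; exists e.
Qed.

Let part_inj f : f \in F -> injective (fun x : J => p (f x)).
Proof.
move=> fF x y /= fxy; have [_ copies _] := ramW.
have [f_inj _] := copies _ (stage_copy st fF).
by apply: f_inj; rewrite !ffunE fxy.
Qed.

Let all_inj h : h \in E :|: extras F -> {in h &, injective p}.
Proof.
case/setUP=> [/(stage_inj st) //|/extrasP[f [x [fF _ ->]]]].
by move=> _ _ /imsetP[y _ ->] /imsetP[z _ ->] /(part_inj fF) ->.
Qed.

Let word_edge_inj w : {in word_edge w &, injective p1}.
Proof.
move=> [q|f] [q'|g]; rewrite !inE //= => /forallP fw /forallP gw fg; congr inr; apply/ffunP => i.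
have /andP[fi /eqP pf] := fw i; have /andP[gi /eqP pg] := gw i.
have [wE _] := TP (w i); apply: (stage_inj st wE) => //.
by rewrite pf fg pg.
Qed.

Let all1_inj h : h \in E1 :|: extras F1 -> {in h &, injective p1}.
Proof.
case/all1P=> [[w ->]|[l [e [ml eE ->]]]]; first exact: word_edge_inj.
move=> _ _ /imsetP[y ye ->] /imsetP[z ze ->]; rewrite !p_psi => yz.
by rewrite (all_inj eE ye ze yz).
Qed.

Let word_edge_proj w : p1 @: word_edge w = d.
Proof.
apply/setP=> i; apply/imsetP/idP => [[v vw ->]|]; first exact: word_edge_inside vw.
have [_ pw] := TP (w i0); rewrite -{1}pw => /imsetP[x xw ->].
have xd : p x \in d by rewrite -pw imset_f.
exists (inr [ffun i => sel (val (w i)) x]).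
  rewrite inE; apply/forallP=> j; rewrite !ffunE.
  have [-> ->] := selP (w j) xd; have [_ ->] := selP (w i0) xd.
  exact: eqxx.
by rewrite /= ffunE; have [_ ->] := selP (w i0) xd.
Qed.

Let all1_outside h v : h \in E1 :|: extras F1 -> v \in h -> p1 v \notin d ->
  exists l x, [/\ moving l, v = psi l x, p x \notin d & h \subset psi l @: setT].
Proof.
case/all1P=> [[w ->]|[l [e [ml eE ->]]]].
  by move/word_edge_inside=> ->.
case/imsetP=> x xe ->; rewrite p_psi => pxd; exists l, x; split=> //.
exact/imsetS/subsetT.
Qed.

(** Covered pairs have distinct parts, so [Q] meets more parts than the three of [d] and has a
    vertex [v] outside them. Every edge through [v] stays in the copy of the line tagging [v]; hence
    all of [Q] does, and it can be pulled back to the previous stage. *)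
Let local1 (Q : {set V1}) : 3 < #|Q| ->
  {in Q &, forall y z, y != z -> covered (E1 :|: extras F1) [set y; z]} ->
  exists2 f : {ffun J -> V1}, f \in F1 & Q \subset f @: setT.
Proof.
move=> cQ covQ.
have [v vQ vd] : exists2 v, v \in Q & p1 v \notin d.
  have : ~~ (p1 @: Q \subset d).
    apply: contraL cQ => /subset_leq_card; rewrite -leqNgt.
    rewrite card_in_imset; first by case: ramW => /(_ d dW) ->.
    move=> y z yQ zQ yz; have [//|yz'] := eqVneq y z.
    have /coveredP[h hE] := covQ y z yQ zQ yz'.
    by rewrite subUset !sub1set => /andP[yh zh]; apply: all1_inj hE y z yh zh yz.
  by case/subsetPn=> _ /imsetP[v vQ ->] vd; exists v.
have outv y : y \in Q -> v != y -> exists l x,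
    [/\ moving l, v = psi l x, p x \notin d & exists z, y = psi l z].
  move=> yQ vy; have /coveredP[h hE] := covQ v y vQ yQ vy.
  rewrite subUset !sub1set => /andP[vh yh].
  have [l [x [ml vE xd hl]]] := all1_outside hE vh vd; exists l, x; split=> //.
  by have /imsetP[z _ ->] := subsetP hl y yh; exists z.
have [v' v'Q] : exists v', v' \in Q :\ v.
  by apply/card_gt0P; move: cQ; rewrite (cardsD1 v) vQ; case: #|_|.
move: v'Q; rewrite !inE eq_sym => /andP[vv' v'Q].
have [l [x [ml vE xd _]]] := outv v' v'Q vv'.
have QE : Q = psi l @: (psi l @^-1: Q).
  apply/setP=> y; apply/idP/imsetP => [yQ|[z]]; last by rewrite inE => ? ->.
  have [z yz] : exists z, y = psi l z.
    have [<-|vy] := eqVneq v y; first by exists x.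
    have [l' [x' [_ vE' _ [z ->]]]] := outv y yQ vy; exists z.
    by have [->] := psi_same (etrans (esym vE) vE') xd.
  by exists z; rewrite // inE -yz.
have [||f fF Qf] := @stage_local _ _ _ _ _ _ _ _ st (psi l @^-1: Q).
- by rewrite -(card_imset _ (psi_inj ml)) -QE.
- move=> y z; rewrite !inE => yQ zQ yz.
  apply: (psi_induced_all ml); rewrite imsetU1 imset_set1.
  by apply: covQ; rewrite // (inj_eq (psi_inj ml)).
exists [ffun x : J => psi l (f x)]; first by apply/F1P; exists l, f.
by rewrite comp_imset QE imsetS.
Qed.

(** A pair uncovered in [EW] cannot lie above the edge [d], so one of its vertices carries the tag
    of the line. This fixes the line, and the previous stage fixes the copy. *)
Let determined1 f g : f \in F1 -> g \in F1 ->
  forall u v : J, ~~ covered EW [set p1 (f u); p1 (f v)] ->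
  f @: [set u; v] = g @: [set u; v] -> f = g.
Proof.
case/F1P=> [l [{}f [ml fF ->]]] /F1P[l' [{}g [ml' gF ->]]] u v.
rewrite !comp_imset !ffunE !p_psi => uv fg.
have [x xuv xd] : exists2 x, x \in f @: [set u; v] & p x \notin d.
  have : ~~ ([set p (f u); p (f v)] \subset d).
    by apply: contra uv => uv; apply/coveredP; exists d.
  case/subsetPn=> _ /set2P[] -> pd; [exists (f u)|exists (f v)] => //.
    by rewrite imset_f ?set21.
  by rewrite imset_f ?set22.
have /imsetP[y _ xy] : psi l x \in psi l' @: (g @: [set u; v]).
  by rewrite -fg imset_f.
have [ll _] := psi_same xy xd; rewrite -ll in fg *.
have {}fg : f @: [set u; v] = g @: [set u; v].
  exact: imset_inj (psi_inj ml) _ _ fg.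
by rewrite (stage_determined st fF gF uv fg).
Qed.

(** Colouring each word by its edge gives a monochromatic line [l]. Pulled back along [psi l], the
    colouring depends on the part above [d] as well, so the previous stage applies. *)
Let ramsey1 (c : {set V1} -> bool) :
  (exists chi : {set W} -> bool,
    forall e, e \in E1 -> p1 @: e \notin d |: D -> c e = chi (p1 @: e)) ->
  exists2 f : {ffun J -> V1}, f \in F1 &
    exists b, forall e, e \in EJ -> c (f @: e) = b.
Proof.
move=> [chi chiP]; have [l ml lP] := HJ (fun w => c (word_edge w)).
(* [bd] is the common colour on the line; the value [true] is a default for the case that no edge
   lies above [d]. *)
pose bd := if [pick e : T] is Some e then c (word_edge (fill l e)) else true.
have bdP e : c (word_edge (fill l e)) = bd.
  by rewrite /bd; case: pickP => [e' _|/(_ e)] //=; apply: lP.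
have [|f fF [b bP]] := stage_ramsey st (c := fun A => c (psi l @: A)).
  exists (fun A => if A == d then bd else chi A) => e eE eD.
  case: eqP => [ed|/eqP ed].
    have eT : (e \in E) && (p @: e == d) by rewrite eE ed eqxx.
    by rewrite -(bdP (Sub e eT)) -psi_word_edge SubK.
  rewrite chiP ?p_psi_set ?E1_psi //.
  by rewrite in_setU1 negb_or ed.
exists [ffun x : J => psi l (f x)]; first by apply/F1P; exists l, f.
by exists b => e eJ; rewrite comp_imset bP.
Qed.

Lemma amalgamation_stage : partite_stage EW FW (d |: D) p1 E1 F1.
Proof.
split.
- by move=> e eE; apply: all1_inj; rewrite inE eE.
- move=> _ /E1P[[w ->]|[l [e [_ eE ->]]]]; first by rewrite word_edge_proj.
  by rewrite p_psi_set; apply: stage_proj st _ eE.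
- move=> _ /F1P[l [f [_ fF ->]]].
  suff -> : [ffun x : J => p1 ([ffun x : J => psi l (f x)] x)] = [ffun x : J => p (f x)].
    exact: stage_copy st _ fF.
  by apply/ffunP => y; rewrite !ffunE p_psi.
- move=> _ /F1P[l [f [ml fF ->]]] e eJ.
  by rewrite comp_imset E1_psi // (stage_edge st).
- move=> _ /F1P[l [f [ml fF ->]]] A; rewrite comp_imset => /(psi_induced ml).
  exact: stage_induced st _ fF A.
- move=> _ _ /F1P[l [f [ml fF ->]]] /F1P[l' [g [ml' gF ->]]] A B.
  rewrite !comp_imset => /(psi_coherent ml ml')[|[cA cB]].
    exact: stage_coherent st _ _ fF gF A B.
  by right; split; [apply: stage_induced st _ fF _ cA|
                    apply: stage_induced st _ gF _ cB].
- exact: local1.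
- exact: determined1.
- exact: ramsey1.
Qed.

End Amalgamation.

Lemma partite_construction (W : finType) (EW : {set {set W}})
    (FW : {set {ffun J -> W}}) :
  0 < #|EJ| -> ramsey_family EW FW ->
  exists (V : finType) (p : V -> W) (E : {set {set V}}) (F : {set {ffun J -> V}}),
    partite_stage EW FW EW p E F.
Proof.
move=> J_gt0 ramW.
suff H (s : seq {set W}) : {subset s <= EW} ->
    exists (V : finType) (p : V -> W) (E : {set {set V}}) (F : {set {ffun J -> V}}),
    partite_stage EW FW [set d in s] p E F.
  have [|V [p [E [F st]]]] := H (enum EW); first by move=> d; rewrite mem_enum.
  by exists V, p, E, F; rewrite set_enum in st.
elim: s => [|d s IH] sW.
  have [V [p [E [F st]]]] := initial_stage ramW J_gt0.
  exists V, p, E, F; suff -> : [set d in [::]] = set0 :> {set {set W}} by [].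
  by apply/setP=> d; rewrite !inE.
have [|V [p [E [F st]]]] := IH; first by move=> e es; rewrite sW // inE es orbT.
have dW : d \in EW by rewrite sW // mem_head.
pose T : finType := {e : {set V} | (e \in E) && (p @: e == d)}.
have [I HI] := hales_jewett T bool.
(* A moving coordinate of a line for a constant colouring serves as the element [i0] of [I]. *)
have [l /existsP[i0 _] _] := HI (fun=> true).
have := amalgamation_stage ramW st dW i0 HI.
rewrite set_cons => st'; do 4 eexists; exact: st'.
Qed.

(** Every edge projects into [EW], so for [D = EW] the restriction on colourings is void. The output
    is again a Ramsey family, to which the construction can be applied once more. *)
Lemma partite_ramsey (W : finType) (EW : {set {set W}})
    (FW : {set {ffun J -> W}}) (V : finType) (p : V -> W) (E : {set {set V}})
    (F : {set {ffun J -> V}}) :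
  ramsey_family EW FW -> partite_stage EW FW EW p E F -> ramsey_family E F.
Proof.
move=> [card3 copies _] st; split.
- move=> e eE; rewrite -(card3 _ (stage_proj st eE)).
  by rewrite card_in_imset //; apply: stage_inj st _ eE.
- move=> f fF; split; last exact: stage_edge st _ fF.
  have [f_inj _] := copies _ (stage_copy st fF).
  by move=> x y fxy; apply: f_inj; rewrite !ffunE fxy.
- move=> c; apply: (stage_ramsey st); exists (fun=> true) => e eE.
  by rewrite (stage_proj st eE).
Qed.

(** The starting point of the construction, from Ramsey's theorem for triples; all injections count
    as copies. *)
Lemma complete_ramsey_family :
  (forall e, e \in EJ -> #|e| = 3) ->
  exists (N : nat) (F : {set {ffun J -> 'I_N}}),
    ramsey_family [set e : {set 'I_N} | #|e| == 3] F.
Proof.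
move=> cJ; have [N HN] := ramsey_sets 3 #|J|.
exists N, [set f : {ffun J -> 'I_N} | injectiveb f]; split.
- by move=> e; rewrite inE => /eqP.
- move=> f; rewrite inE => /injectiveP f_inj; split=> // e eJ.
  by rewrite inE card_imset // cJ.
move=> c; have [|X [b [_ cX bP]]] := HN _ [set: 'I_N] c.
  by rewrite cardsT card_ord.
pose f : {ffun J -> 'I_N} :=
  [ffun x => enum_val (cast_ord (esym cX) (enum_rank x))].
have f_inj : injective f.
  by move=> x y; rewrite !ffunE => /enum_val_inj/cast_ord_inj/enum_rank_inj.
exists f; first by rewrite inE; apply/injectiveP.
exists b => e eJ; apply: bP; last by rewrite card_imset // cJ.
apply/subsetP=> _ /imsetP[x _ ->]; rewrite ffunE; exact: enum_valP.
Qed.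

End Partite.

(** * Cliques, minimality and the lower bound *)

Definition mono_clique (T : finType) (t : nat) (E : {set {set T}})
    (c : {set T} -> bool) (b : bool) (Q : {set T}) : Prop :=
  #|Q| = t /\
  forall g : {set T}, g \subset Q -> #|g| = 3 -> g \in E /\ c g = b.

Definition arrow (T : finType) (t : nat) (E : {set {set T}}) : Prop :=
  forall c : {set T} -> bool, exists b Q, mono_clique t E c b Q.

Lemma exists_third (T : finType) (Q : {set T}) (x y : T) :
  2 < #|Q| -> exists z, [/\ z \in Q, z != x & z != y].
Proof.
move=> cQ; suff /set0Pn[z] : Q :\: [set x; y] != set0.
  by rewrite !inE negb_or => /andP[/andP[zx zy] zQ]; exists z.
rewrite -card_gt0 cardsD subn_gt0; apply: leq_ltn_trans cQ.
apply: leq_trans (subset_leq_card (subsetIr _ _)) _.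
by rewrite cards2; case: (_ != _).
Qed.

Lemma card_triple (T : finType) (x y z : T) :
  x != y -> z != x -> z != y -> #|[set x; y; z]| = 3.
Proof.
by move=> xy zx zy; rewrite setUC cardsU1 cards2 xy !inE negb_or zx zy.
Qed.

Lemma triple_sub (T : finType) (Q : {set T}) (x y z : T) :
  x \in Q -> y \in Q -> z \in Q -> [set x; y; z] \subset Q.
Proof. by move=> xQ yQ zQ; rewrite !subUset !sub1set xQ yQ. Qed.

Lemma ramseyP (T : finType) (t : nat) (H : hypergraph3 T) : 2 < t ->
  ramsey 2 (complete3 t) H <-> arrow t (edges H).
Proof.
move=> t_gt2; split=> [ram c|arr c].
  have [f [i [f_inj _ fP]]] := ram (fun g => if c g then ord0 else ord_max).
  have finj : injective f by move=> x y; apply: f_inj; rewrite inE.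
  exists (i == ord0), (f @: setT); split.
    by rewrite card_imset // cardsT card_ord.
  move=> g gf cg; have gE : g = f @: (f @^-1: g).
    apply/setP=> x; apply/idP/imsetP => [xg|[y]]; last by rewrite inE => ? ->.
    by have /imsetP[y _ xy] := subsetP gf x xg; exists y; rewrite // inE -xy.
  have [|] := fP (f @^-1: g).
    by rewrite inE -(card_imset _ finj) -gE cg.
  by rewrite -gE => gH <-; split=> //; case: (c g).
have [b [Q [cQ QP]]] := arr (fun g => c g == ord0).
pose f (i : 'I_t) : T := enum_val (cast_ord (esym cQ) i).
have f_inj : injective f by move=> x y /enum_val_inj/cast_ord_inj.
have fQ i : f i \in Q by apply: enum_valP.
have fgQ (g : {set 'I_t}) : f @: g \subset Q.
  by apply/subsetP=> _ /imsetP[i _ ->].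
exists f, (if b then ord0 else ord_max); split.
- by move=> x y _ _; apply: f_inj.
(* Since [t > 2], each clique vertex lies in a triple of the clique, that is in an edge, and hence
   in [verts H]. *)
- apply/subsetP=> x /(subsetP (fgQ _)) xQ.
  have [y [yQ yx _]] : exists z, [/\ z \in Q, z != x & z != x].
    by apply: exists_third; rewrite cQ.
  have [z [zQ zx zy]] : exists z, [/\ z \in Q, z != x & z != y].
    by apply: exists_third; rewrite cQ.
  have [|gH _] := QP [set x; y; z] (triple_sub xQ yQ zQ).
    by rewrite card_triple // eq_sym.
  have /forall_inP/(_ _ gH)/andP[/subsetP gV _] := edgesP H.
  by apply: gV; rewrite !inE eqxx.
- move=> g; rewrite inE => /eqP cg.
  have [|gH cP] := QP (f @: g) (fgQ g); first by rewrite card_imset.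
  split=> //; rewrite -cP; case: eqP => [->//|].
  by case: (c _) => [] [|[|//]] k ne; apply/val_inj => //; case: ne; apply/val_inj.
Qed.

Lemma hypergraph_eq (T : finType) (H1 H2 : hypergraph3 T) :
  verts H1 = verts H2 -> edges H1 = edges H2 -> H1 = H2.
Proof.
case: H1 => V1 E1 P1; case: H2 => V2 E2 P2 /= VV EE.
by move: P1 P2; rewrite VV EE => P1 P2; rewrite (bool_irrelevance P1 P2).
Qed.

Lemma minimal_ramsey_sub (r : nat) (U T : finType) (K : hypergraph3 U)
    (H : hypergraph3 T) :
  ramsey r K H ->
  exists2 G : hypergraph3 T, subhypergraph G H & minimal_ramsey r K G.
Proof.
have [n] := ubnP (#|verts H| + #|edges H|); elim: n H => // n IH H.
rewrite ltnS => Hn ramH.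
have [HK|] := classic (forall H' : hypergraph3 T,
    proper_subhypergraph H' H -> ~ ramsey r K H').
  by exists H; [rewrite /subhypergraph !subxx|split].
move=> nmin; have [H' nH'] := not_all_ex_not _ _ nmin.
have [properH' /NNPP ram'] := imply_to_and _ _ nH'.
have [/andP[sV sE] neq] := properH'.
have [|G /andP[GV GE] minG] := IH H' _ ram'; last first.
  by exists G => //; apply/andP; split; [apply: subset_trans sV|apply: subset_trans sE].
apply: leq_trans Hn; rewrite ltnNge; apply/negP=> le; case: neq.
have cV := subset_leq_card sV; have cE := subset_leq_card sE.
apply: hypergraph_eq; apply/eqP; rewrite eqEcard ?sV ?sE /=.
  by rewrite -(leq_add2r #|edges H|) (leq_trans le) // leq_add2l.
by rewrite -(leq_add2l #|verts H|) (leq_trans le) // leq_add2r.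
Qed.

(** * Lower bound for positive pair codegrees *)

Section LowerBound.

Variables (T : finType) (t : nat) (E : {set {set T}}) (S : {set T}).
Hypotheses (t_gt3 : 3 < t) (cS : #|S| = 2).

Let link := [set w | (w \notin S) && (w |: S \in E)].

Let card_link : #|link| <= #|[set e in E | S \subset e]|.
Proof.
rewrite -(card_in_imset (f := fun w => w |: S)).
  apply: subset_leq_card; apply/subsetP=> _ /imsetP[w wL ->].
  by move: wL; rewrite !inE subsetUr andbT => /andP[].
move=> x y; rewrite !inE => /andP[xS _] /andP[yS _] /setP/(_ x).
by rewrite !inE eqxx (negPf xS) !orbF => /esym/eqP.
Qed.

(** A set which threatens to form with [S] a clique of colour [b] as soon as all triples joining it
    to [S] receive the colour [b]. Red is [true] and blue is [false]. *)
Let petal (c : {set T} -> bool) (b : bool) (W : {set T}) : Prop :=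
  [/\ W \subset link, #|W| = t - 2 &
    forall g : {set T}, g \subset W :|: S -> #|g| = 3 -> ~~ (S \subset g) ->
      c g = b].

(** Two common vertices and one vertex of [S] would form a triple of both colours. *)
Let petal_meet c (W W' : {set T}) :
  petal c true W -> petal c false W' -> #|W' :&: W| <= 1.
Proof.
move=> [WL _ WP] [WL' _ WP']; rewrite leqNgt; apply/negP=> /card_gt1P[x [y [xW yW xy]]].
have [u uS] : exists u, u \in S by apply/card_gt0P; rewrite cS.
move: xW yW; rewrite !inE => /andP[xW' xW] /andP[yW' yW].
have xS : x \notin S by have := subsetP WL x xW; rewrite inE => /andP[].
have yS : y \notin S by have := subsetP WL y yW; rewrite inE => /andP[].
have cg : #|[set x; y; u]| = 3.
  by rewrite card_triple //; [apply: contraNneq xS|apply: contraNneq yS] => <-.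
have Sg : ~~ (S \subset [set x; y; u]).
  apply/negP=> Sg; have : S \subset [set u].
    apply/subsetP=> z zS; have := subsetP Sg z zS; rewrite !inE.
    by case/orP=> [/orP[]|//] /eqP zE; [rewrite -zE zS in xS|rewrite -zE zS in yS].
  by move/subset_leq_card; rewrite cS cards1.
have := WP _ (triple_sub _ _ _) cg Sg; rewrite !inE xW yW uS orbT => /(_ isT isT isT).
have := WP' _ (triple_sub _ _ _) cg Sg; rewrite !inE xW' yW' uS orbT => /(_ isT isT isT).
by move=> ->.
Qed.

Lemma pair_codegree_lower_bound :
  arrow t E -> ~ arrow t [set e in E | ~~ (S \subset e)] ->
  (t - 2) ^ 2 <= #|[set e in E | S \subset e]|.
Proof.
move=> arrE narr; rewrite leqNgt; apply/negP=> small.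
have [c cP] := not_all_ex_not _ _ narr.
have L_small : #|link| < (t - 2) * (t - 2).
  by rewrite mulnn; apply: leq_ltn_trans card_link small.
(* [R] is the union of a maximal family of [m] disjoint petals of colour
   [true]. *)
have [m [R [RL cR RF RT]]] : exists m (R : {set T}), [/\ R \subset link,
    #|R| = m * (t - 2), forall W, petal c false W -> #|W :&: R| <= m &
    forall W, petal c true W -> ~~ [disjoint W & R]].
  (* Petals are added greedily. The fuel [n] suffices because every new petal enlarges [R] inside
     the link, and by [petal_meet] it adds at most one vertex to the intersection with a blue
     petal. *)
  suff grow n m (R : {set T}) : #|link| < n + #|R| -> R \subset link ->
      #|R| = m * (t - 2) -> (forall W, petal c false W -> #|W :&: R| <= m) ->
      exists m (R : {set T}), [/\ R \subset link,
    #|R| = m * (t - 2), forall W, petal c false W -> #|W :&: R| <= m &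
    forall W, petal c true W -> ~~ [disjoint W & R]].
    apply: (grow #|link|.+1 0 set0); rewrite ?cards0 ?addn0 ?sub0set //.
    by move=> W _; rewrite setI0 cards0.
  elim: n m R => [|n IH] m R ltn RL cR RF.
    by move: ltn; rewrite ltnNge add0n (subset_leq_card RL).
  have [RT|] := classic (forall W, petal c true W -> ~~ [disjoint W & R]).
    by exists m, R.
  move=> nRT; have [W nW] := not_all_ex_not _ _ nRT.
  have [WT /negP/negPn WR] := imply_to_and _ _ nW.
  have [WL cW _] := WT.
  have cU : #|W :|: R| = #|W| + #|R|.
    by rewrite cardsU disjoint_setI0 // cards0 subn0.
  apply: (IH m.+1 (W :|: R)).
  - apply: leq_trans ltn _; rewrite cU cW addSnnS leq_add2l -addn1 addnC.
    by rewrite leq_add2r subn_gt0 ltnW // ltnW.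
  - by rewrite subUset WL.
  - by rewrite cU cW cR mulSn.
  - move=> W' W'F; rewrite setIUr; apply: leq_trans (leq_card_setU _ _) _.
    by rewrite -[m.+1]add1n; apply: leq_add; [apply: petal_meet WT W'F|apply: RF].
have m_lt : m < t - 2.
  rewrite -(ltn_pmul2r (m := t - 2)) ?subn_gt0; last by rewrite ltnW // ltnW.
  by rewrite -cR; apply: leq_ltn_trans (subset_leq_card RL) L_small.
(* A triple containing [S] becomes blue exactly when it meets [R]. A monochromatic clique must
   contain [S], by the choice of [c]. *)
have [b [Q [cQ QP]]] :=
  arrE (fun g => if S \subset g then [disjoint g & R] else c g).
have [SQ|SQ] := boolP (S \subset Q); last first.
  apply: cP; exists b, Q; split=> // g gQ cg.
  have Sg : ~~ (S \subset g) by apply: contra SQ => /subset_trans; apply.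
  by have [gE] := QP g gQ cg; rewrite inE gE (negPf Sg).
pose W := Q :\: S.
have wP w : w \in W -> w \in link /\ [disjoint w |: S & R] = b.
  rewrite inE => /andP[wS wQ]; have [||wE] := QP (w |: S).
  - by rewrite subUset sub1set wQ.
  - by rewrite cardsU1 wS cS.
  by rewrite subsetUr => <-; rewrite inE wS wE.
have SR : [disjoint S & R].
  rewrite disjoint_sym; apply: disjointWl RL _.
  by rewrite disjoint_subset; apply/subsetP=> w; rewrite !inE => /andP[].
have cW : #|W| = t - 2 by rewrite cardsDS // cQ cS.
have Wp : petal c b W.
  split=> //; first by apply/subsetP=> w /wP[].
  move=> g gWS cg Sg; have gQ : g \subset Q.
    by apply: subset_trans gWS _; rewrite subUset subsetDl.
  by have [_] := QP g gQ cg; rewrite (negPf Sg).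
have wR w : w \in W -> (w \in R) = ~~ b.
  move=> /wP[_ <-]; suff -> : [disjoint w |: S & R] = (w \notin R) by rewrite negbK.
  rewrite -[RHS]andbT -SR -disjointU1; apply: eq_disjoint => x.
  by rewrite !inE.
(* A red clique would leave a red petal disjoint from [R], against maximality. A blue one would
   leave a petal of [t - 2] vertices inside [R], although blue petals meet [R] in at most
   [m < t - 2] vertices. *)
case: b wP Wp wR {QP} => wP Wp wR.
  case/negP: (RT W Wp); rewrite disjoint_subset; apply/subsetP=> w wW.
  by rewrite inE /= wR.
have WR : W \subset R by apply/subsetP=> w wW; rewrite wR.
by have := RF W Wp; rewrite (setIidPl WR) cW leqNgt m_lt.
Qed.

End LowerBound.

(** * The forcing gadget *)

Section Gadget.

Variable t : nat.
Hypothesis t_gt3 : 3 < t.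

(* Two apexes and a square grid; [gadget] adds to every set of core vertices
   [t - 3] private vertices. *)
Definition core : finType := (bool + 'I_(t - 2) * 'I_(t - 2))%type.

Definition gadget : finType := (core + {set core} * 'I_(t - 3))%type.

Definition apexes : {set core} := [set inl true; inl false].

Definition same_row (e : {set core}) : bool :=
  [forall x, forall y, (inr x \in e) ==> (inr y \in e) ==> (x.1 == y.1)].

Definition distinct_rows (e : {set core}) : bool :=
  [forall x, forall y,
     (inr x \in e) ==> (inr y \in e) ==> (x != y) ==> (x.1 != y.1)].

Definition row_triples : {set {set core}} :=
  [set e : {set core} | [&& #|e| == 3, ~~ (apexes \subset e) & same_row e]].

Definition transversal_triples : {set {set core}} :=
  [set e : {set core} | [&& #|e| == 3, ~~ (apexes \subset e) & distinct_rows e]].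

Definition apex_triple (w : 'I_(t - 2) * 'I_(t - 2)) : {set core} :=
  inr w |: apexes.

Definition apex_triples : {set {set core}} := [set apex_triple w | w in setT].

Definition incore (e : {set core}) : {set gadget} := inl @: e.

Definition petal_clique (e : {set core}) : {set gadget} :=
  [set v | match v with inl x => x \in e | inr q => q.1 == e end].

(** These triples play the role of [EJ]: the partite construction supplies copies in which they all
    have one colour. The [forced_triples] play the role of [XJ]. *)
Definition forcing_triples : {set {set gadget}} :=
  (incore @: row_triples) :|:
  [set g : {set gadget} | (#|g| == 3) &&
    [exists e in transversal_triples, (g \subset petal_clique e) && (g != incore e)]].

Definition forced_triples : {set {set gadget}} :=
  incore @: (transversal_triples :|: apex_triples).

Implicit Types (e : {set core}) (g : {set gadget}).

Lemma incore_inj : injective incore.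
Proof. by apply: imset_inj => x y []. Qed.

Lemma card_incore e : #|incore e| = #|e|.
Proof. by rewrite card_imset // => x y []. Qed.

Lemma mem_incore x e : (inl x \in incore e) = (x \in e).
Proof. by rewrite mem_imset // => y z []. Qed.

Lemma incore_sub e1 e2 : (incore e1 \subset incore e2) = (e1 \subset e2).
Proof.
apply/subsetP/subsetP=> H x; first by rewrite -!mem_incore => /H.
by case/imsetP=> y ye ->; rewrite mem_incore H.
Qed.

Lemma incore_petal e : incore e \subset petal_clique e.
Proof. by apply/subsetP=> _ /imsetP[x xe ->]; rewrite inE. Qed.

Lemma incore_sub_petal e1 e2 : incore e1 \subset petal_clique e2 -> e1 \subset e2.
Proof.
by move/subsetP=> H; apply/subsetP=> x; rewrite -mem_incore => /H; rewrite inE.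
Qed.

Lemma apexes_card e : apexes \subset e -> #|e| = 3 -> exists w, e = apex_triple w.
Proof.
move=> ae ce; have e3 : 2 < #|e| by rewrite ce.
have [x [xe xt xf]] := exists_third (inl true) (inl false) e3.
case: x xe xt xf => [[]|w] //= we _ _; exists w; apply/eqP.
rewrite eq_sym eqEcard subUset sub1set we ae ce.
by rewrite cardsU1 cards2 !inE.
Qed.

Lemma apex_triple_card w : #|apex_triple w| = 3.
Proof. by rewrite cardsU1 cards2 !inE. Qed.

Lemma row_triplesP e : e \in row_triples ->
  [/\ #|e| = 3, ~~ (apexes \subset e) &
    forall x y, inr x \in e -> inr y \in e -> x.1 = y.1].
Proof.
rewrite inE => /and3P[/eqP ce ae /forallP re]; split=> // x y xe ye.
by move/forallP/(_ y): (re x); rewrite xe ye => /eqP.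
Qed.

Lemma transversal_triplesP e : e \in transversal_triples ->
  [/\ #|e| = 3, ~~ (apexes \subset e) &
    forall x y, inr x \in e -> inr y \in e -> x != y -> x.1 != y.1].
Proof.
rewrite inE => /and3P[/eqP ce ae /forallP re]; split=> // x y xe ye xy.
by move/forallP/(_ y): (re x); rewrite xe ye xy.
Qed.

Lemma two_grid_points (e : {set core}) : 2 < #|e| -> ~~ (apexes \subset e) ->
  exists x y, [/\ inr x \in e, inr y \in e & x != y].
Proof.
move=> ce ae.
have [b bP] : exists b, inl b \notin e.
  by case/subsetPn: ae => _ /set2P[]->; [exists true|exists false].
have [x [xe xb _]] : exists x, [/\ x \in e, x != inl (~~ b) & x != inl (~~ b)].
  exact: exists_third.
have [y [ye yb yx]] : exists y, [/\ y \in e, y != inl (~~ b) & y != x].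
  exact: exists_third.
have grid z : z \in e -> z != inl (~~ b) -> exists w, z = inr w.
  case: z => [a|w] ze za; last by exists w.
  case: (eqVneq a b) => [ab|ab]; first by rewrite ab (negPf bP) in ze.
  by case: a b za ab {ze bP xb yb} => -[].
have [w wE] := grid x xe xb; have [w' wE'] := grid y ye yb.
exists w, w'; rewrite -wE -wE'; split=> //.
by apply: contraNneq yx => ww; rewrite wE wE' ww.
Qed.

Lemma row_not_transversal e : e \in row_triples -> e \notin transversal_triples.
Proof.
move=> /row_triplesP[ce ae rowe]; apply/negP=> /transversal_triplesP[_ _ te].
have [|x [y [xe ye xy]]] := two_grid_points _ ae; first by rewrite ce.
by have := te x y xe ye xy; rewrite (rowe x y xe ye) eqxx.
Qed.

Lemma apex_triplesP e : e \in apex_triples -> exists w, e = apex_triple w.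
Proof. by case/imsetP=> w _ ->; exists w. Qed.

Lemma forcing_card g : g \in forcing_triples -> #|g| = 3.
Proof.
case/setUP=> [/imsetP[e /row_triplesP[ce _ _] ->]|]; first by rewrite card_incore.
by rewrite inE => /andP[/eqP].
Qed.

Lemma forced_card g : g \in forced_triples -> #|g| = 3.
Proof.
case/imsetP=> e eP ->; rewrite card_incore; case/setUP: eP.
  by case/transversal_triplesP.
by case/apex_triplesP=> w ->; rewrite apex_triple_card.
Qed.

Lemma forcing_incore e : incore e \in forcing_triples -> e \in row_triples.
Proof.
case/setUP=> [/imsetP[e' e'R /incore_inj->] //|].
rewrite inE card_incore => /andP[/eqP ce /exists_inP[e' e'P /andP[sub]]].
have [ce' _ _] := transversal_triplesP e'P.
suff -> : e = e' by rewrite eqxx.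
by apply/eqP; rewrite eqEcard (incore_sub_petal sub) ce ce'.
Qed.

Lemma forcing_petal e g : e \in transversal_triples -> g \subset petal_clique e ->
  #|g| = 3 -> g != incore e -> g \in forcing_triples.
Proof.
move=> eP ge cg gne; apply/setUP; right; rewrite inE cg eqxx /=.
by apply/exists_inP; exists e => //; rewrite ge.
Qed.

Lemma forcing_induced (A : {set gadget}) :
  #|A| = 3 -> covered forcing_triples A -> A \in forcing_triples.
Proof.
move=> cA /coveredP[h hF Ah].
suff -> : A = h by [].
by apply/eqP; rewrite eqEcard Ah cA (forcing_card hF).
Qed.

(** This rules out the second alternative of [stage_coherent], so the image of a forced triple has
    the same preimage in every copy containing it. *)
Lemma forced_not_covered g : g \in forced_triples -> ~~ covered forcing_triples g.
Proof.
move=> gX; apply/negP=> /(forcing_induced (forced_card gX)).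
case/imsetP: gX => e eX -> /forcing_incore eR; case/setUP: eX.
  by apply/negP; apply: row_not_transversal.
case/apex_triplesP=> w eE; have [_ /negP[]] := row_triplesP eR.
by rewrite eE subsetUr.
Qed.

Lemma apexes_not_covered : ~~ covered forcing_triples (incore apexes).
Proof.
apply/negP=> /coveredP[g /setUP[/imsetP[e eR ->]|]].
  by rewrite incore_sub; have [_ /negP] := row_triplesP eR.
rewrite inE => /andP[_ /exists_inP[e eP /andP[ge _]]] ag.
have [_ /negP[]] := transversal_triplesP eP.
exact: incore_sub_petal (subset_trans ag ge).
Qed.

(** At most one apex occurs, leaving at least [t - 1] grid points. If their rows are distinct, there
    are at most [t - 2] of them. Otherwise two points share a row, every triple through both is a
    row triple, all points lie in that row, and the columns give the same bound. *)
Lemma core_clique (Q : {set core}) :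
  (forall g : {set core}, g \subset Q -> #|g| = 3 ->
    g \in row_triples :|: transversal_triples) ->
  #|Q| <> t.
Proof.
move=> QP cQ.
have Q3 : 2 < #|Q| by rewrite cQ ltnW.
have nonap (g : {set core}) : g \in row_triples :|: transversal_triples ->
    ~~ (apexes \subset g).
  by case/setUP=> [/row_triplesP[]|/transversal_triplesP[]].
have aQ : ~~ (apexes \subset Q).
  apply/negP=> aQ; have [z [zQ zt zf]] := exists_third (inl true) (inl false) Q3.
  have [tQ fQ] : inl true \in Q /\ inl false \in Q.
    by split; apply: (subsetP aQ); rewrite !inE.
  have tf : inl true != inl false :> core by [].
  have /nonap/negP[] := QP _ (triple_sub tQ fQ zQ) (card_triple tf zt zf).
  exact: subsetUl.
have [b bP] : exists b, inl b \notin Q.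
  by case/subsetPn: aQ => _ /set2P[]->; [exists true|exists false].
pose L := [set w | inr w \in Q].
have cL : #|Q| <= #|L|.+1.
  have : Q \subset inl (~~ b) |: inr @: L.
    apply/subsetP=> -[a|w] xQ; last by rewrite !inE imset_f ?inE.
    suff -> : a = ~~ b by rewrite !inE eqxx.
    by case: a b bP xQ => -[] //; [move=> /negPf->|move=> /negPf->].
  move/subset_leq_card/leq_trans; apply.
  rewrite cardsU1 -[#|L|.+1]add1n.
  by apply: leq_add; [apply: leq_b1|apply: leq_imset_card].
have small (f : 'I_(t - 2) * 'I_(t - 2) -> 'I_(t - 2)) : {in L &, injective f} -> False.
  move=> f_inj; have := max_card (mem (f @: L)).
  rewrite card_in_imset // card_ord -ltnS => /(leq_trans cL); rewrite cQ.
  by rewrite -{1}(subnK (ltnW (ltnW t_gt3))) addn2 ltnn.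
apply: (small fst) => x y xL yL xy1; case: (eqVneq x y) => // xy; exfalso.
have row z : z \in L -> z.1 = x.1.
  move=> zL; case: (eqVneq z x) => [->//|zx]; case: (eqVneq z y) => [->//|zy].
  move: xL yL zL; rewrite !inE => xQ yQ zQ.
  have inr_neq (u v : 'I_(t - 2) * 'I_(t - 2)) : u != v -> inr u != inr v :> core.
    by apply: contraNneq => -[->].
  have := QP _ (triple_sub xQ yQ zQ)
    (card_triple (inr_neq _ _ xy) (inr_neq _ _ zx) (inr_neq _ _ zy)).
  case/setUP=> [/row_triplesP[_ _]|/transversal_triplesP[_ _ /(_ x y)]].
    by apply; rewrite !inE eqxx ?orbT.
  by rewrite !inE !eqxx ?orbT xy1 eqxx => /(_ isT isT xy).
apply: (small snd) => u v uL vL uv.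
by apply/eqP; rewrite -pair_eqE /pair_eq /= uv row // row // !eqxx.
Qed.

Lemma card_petal_clique e : #|e| = 3 -> #|petal_clique e| = t.
Proof.
move=> ce; have -> : petal_clique e =
    incore e :|: (fun i : 'I_(t - 3) => inr (e, i)) @: setT.
  apply/setP=> -[x|[e' i]]; rewrite !inE ?mem_incore.
    by rewrite orbC; case: imsetP => [[]|].
  rewrite /=; apply/eqP/orP => [->|[/imsetP[]//|/imsetP[j _ []->//]]].
  by right; apply/imsetP; exists i.
rewrite cardsU card_incore ce card_imset; last by move=> i j [].
rewrite cardsT card_ord (_ : _ :&: _ = set0) ?cards0 ?subn0 ?subnKC //.
  exact: ltnW.
apply/eqP/set0Pn=> -[v]; rewrite inE => /andP[/imsetP[x _ ->] /imsetP[]//].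
Qed.

(** All triples at a private vertex lie inside its petal clique, so a clique using one is that petal
    clique, by cardinality. Any other clique stays in the core. *)
Lemma gadget_clique (Q : {set gadget}) :
  #|Q| = t ->
  (forall g : {set gadget}, g \subset Q -> #|g| = 3 ->
    g \in forcing_triples :|: forced_triples) ->
  (exists2 e, e \in transversal_triples & Q = petal_clique e) \/
  exists2 Q0 : {set core}, Q = incore Q0 &
    forall g : {set core}, g \subset Q0 -> #|g| = 3 ->
      g \in row_triples :|: transversal_triples :|: apex_triples.
Proof.
move=> cQ QP; have Q3 : 2 < #|Q| by rewrite cQ ltnW.
case: (pickP [pred q | inr q \in Q]) => [q /= qQ|Qcore].
  left.
  have petal g : g \in forcing_triples :|: forced_triples -> inr q \in g ->
      q.1 \in transversal_triples /\ g \subset petal_clique q.1.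
    case/setUP=> [/setUP[/imsetP[e _ ->] /imsetP[]//|]|/imsetP[e _ ->] /imsetP[]//].
    rewrite inE => /andP[_ /exists_inP[e eP /andP[ge _]]] qg.
    by move: (subsetP ge _ qg); rewrite inE => /eqP->.
  have third x : x \in Q -> x != inr q ->
     q.1 \in transversal_triples /\ x \in petal_clique q.1.
    move=> xQ xq; have [z [zQ zq zx]] := exists_third (inr q) x Q3.
    have gX := QP _ (triple_sub qQ xQ zQ) (card_triple _ zq zx).
    rewrite eq_sym in xq; have [|qP] := petal _ (gX xq); first by rewrite !inE eqxx.
    by move=> /subsetP/(_ x) gq; split=> //; apply: gq; rewrite !inE eqxx orbT.
  have [x [xQ xq _]] := exists_third (inr q) (inr q) Q3.
  have [qP _] := third x xQ xq; exists q.1 => //.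
  apply/eqP; rewrite eqEcard; apply/andP; split.
    apply/subsetP=> y yQ; case: (eqVneq y (inr q)) => [->|]; first by rewrite inE.
    by move=> yq; have [] := third y yQ yq.
  by have [cq _ _] := transversal_triplesP qP; rewrite card_petal_clique ?cQ.
right; exists [set x | inl x \in Q].
  apply/setP=> -[x|q]; first by rewrite mem_incore inE.
  have := Qcore q; rewrite /= => ->; apply/esym/negbTE/negP.
  by case/imsetP.
move=> g gQ cg; have := QP (incore g); rewrite card_incore cg.
have gQ' : incore g \subset Q.
  by apply/subsetP=> _ /imsetP[x xg ->]; have := subsetP gQ x xg; rewrite inE.
case/(_ gQ' erefl)/setUP=> [/forcing_incore gR|/imsetP[e eX /incore_inj->]].
  by rewrite -setUA in_setU gR.
by rewrite -setUA in_setU eX orbT.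
Qed.

Lemma no_forcing_clique (Q : {set gadget}) :
  (forall g : {set gadget}, g \subset Q -> #|g| = 3 -> g \in forcing_triples) ->
  #|Q| <> t.
Proof.
move=> QP cQ.
case: (gadget_clique cQ) => [g gQ cg|[e eP QE]|[Q0 QE Q0P]].
- by rewrite inE QP.
- have [ce _ _] := transversal_triplesP eP.
  have := QP (incore e); rewrite card_incore ce QE incore_petal.
  move=> /(_ isT erefl)/forcing_incore/row_not_transversal.
  by rewrite eP.
- apply: (@core_clique Q0); last by rewrite -cQ QE card_incore.
  move=> g gQ cg; rewrite inE forcing_incore // QP ?card_incore //.
  by rewrite QE incore_sub.
Qed.

Lemma no_transversal_clique (Q : {set gadget}) :
  (forall g : {set gadget}, g \subset Q -> #|g| = 3 ->
    g \in incore @: transversal_triples) ->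
  #|Q| <> t.
Proof.
move=> QP cQ.
case: (gadget_clique cQ) => [g gQ cg|[e eP QE]|[Q0 QE Q0P]].
- have /imsetP[e eP ->] := QP g gQ cg.
  by apply/setUP; right; apply: imset_f; rewrite inE eP.
- have [ce _ _] := transversal_triplesP eP.
  have i0 : 'I_(t - 3) by exists 0; rewrite subn_gt0.
  have [x xe] : exists x, x \in e by apply/card_gt0P; rewrite ce.
  have [y [ye yx _]] : exists y, [/\ y \in e, y != x & y != x].
    by apply: exists_third; rewrite ce.
  have [||e' _ E] := imsetP (QP [set inl x; inl y; inr (e, i0)] _ _).
  + by apply: triple_sub; rewrite QE inE.
  + by rewrite card_triple // eq_sym.
  + have /imsetP[] // : inr (e, i0) \in incore e'.
    by rewrite -E !inE eqxx orbT.
- apply: (@core_clique Q0); last by rewrite -cQ QE card_incore.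
  move=> g gQ cg; have := QP (incore g); rewrite card_incore cg QE incore_sub gQ.
  by case/(_ isT erefl)/imsetP=> e eP /incore_inj->; rewrite inE eP orbT.
Qed.

(* Every clique of the gadget contains exactly one marked vertex, so colouring
   the triples by whether they contain a marked vertex leaves none
   monochromatic. *)
Definition marked (v : gadget) : bool :=
  match v with
  | inl x => x == inl true
  | inr q => (nat_of_ord q.2 == 0) && (inl true \notin q.1)
  end.

Lemma one_marked (Q : {set gadget}) :
  #|Q| = t ->
  (forall g : {set gadget}, g \subset Q -> #|g| = 3 ->
    g \in forcing_triples :|: forced_triples) ->
  exists v, [/\ v \in Q, marked v & forall v', v' \in Q -> marked v' -> v' = v].
Proof.
move=> cQ QP; case: (gadget_clique cQ QP) => [[e eP QE]|[Q0 QE Q0P]].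
  have i0P : 0 < t - 3 by rewrite subn_gt0.
  have [ue|ue] := boolP (inl true \in e).
    exists (inl (inl true)); split; rewrite ?QE ?inE //.
    move=> [x _ /eqP->//|[e' i]]; rewrite inE /= => /eqP->.
    by rewrite ue andbF.
  exists (inr (e, Ordinal i0P)); split; rewrite ?QE ?inE //=.
  move=> [x|[e' i]]; rewrite inE /=; first by move=> + /eqP xE; rewrite xE (negPf ue).
  move=> /eqP-> /andP[/eqP i0 _]; congr (inr (_, _)); exact: val_inj.
have uQ : inl true \in Q0.
  apply: contraTT isT => uQ; exfalso.
  apply: (@core_clique Q0); last by rewrite -cQ QE card_incore.
  move=> g gQ cg; have /setUP[//|/apex_triplesP[w gE]] := Q0P g gQ cg.
  by case/negP: uQ; apply: (subsetP gQ); rewrite gE !inE eqxx orbT.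
exists (inl (inl true)); split=> //; first by rewrite QE mem_incore.
move=> [x|q]; first by move=> _ /eqP->.
by rewrite QE => /imsetP[].
Qed.

Lemma gadget_not_ramsey :
  exists c : {set gadget} -> bool, forall b (Q : {set gadget}),
    ~ mono_clique t (forcing_triples :|: forced_triples) c b Q.
Proof.
exists (fun g => [exists v in g, marked v]) => b Q [cQ QP].
have [|v [vQ mv vP]] := one_marked cQ; first by move=> g gQ /QP[].
have Q3 : 2 < #|Q| by rewrite cQ ltnW.
have [x [xQ xv _]] := exists_third v v Q3.
have [y [yQ yv yx]] := exists_third v x Q3.
rewrite eq_sym in xv.
have [_ bT] := QP _ (triple_sub vQ xQ yQ) (card_triple xv yv yx).
(* As [t > 3], some triple of the clique avoids the marked vertex and has the other colour. *)
have [|X XQ cX] := @subset_of_card _ (Q :\ v) 3.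
  by move: t_gt3; rewrite -cQ (cardsD1 v) vQ.
have [_] := QP X (subset_trans XQ (subsetDl _ _)) cX.
have -> : b = true by rewrite -bT; apply/exists_inP; exists v; rewrite // !inE eqxx.
case/exists_inP=> u uX mu.
have := subsetP XQ u uX; rewrite !inE => /andP[/eqP uv uQ].
exact: uv (vP u uQ mu).
Qed.

Lemma forcing_nonempty : 0 < #|forcing_triples|.
Proof.
have s_gt1 : 1 < t - 2 by rewrite ltn_subRL.
have s_gt0 := ltnW s_gt1.
pose w j : core := inr (Ordinal s_gt0, j).
apply/card_gt0P; exists (incore [set inl true; w (Ordinal s_gt0); w (Ordinal s_gt1)]).
apply/setUP; left; apply: imset_f; rewrite inE card_triple //=.
apply/andP; split.
  by apply/subsetPn; exists (inl false); rewrite !inE.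
apply/forallP=> x; apply/forallP=> y; rewrite !inE /=.
apply/implyP=> /orP[]/eqP[->]; apply/implyP=> /orP[]/eqP[->] //=.
Qed.

(** Serves both outcomes of [forcing], where [W] is a full row or picks one point per row. *)
Lemma spanned_clique (c : {set gadget} -> bool) b
    (W : {set 'I_(t - 2) * 'I_(t - 2)}) :
  #|W| = t - 2 ->
  (forall w, w \in W -> c (incore (apex_triple w)) = b) ->
  (forall e, #|e| = 3 -> ~~ (apexes \subset e) ->
     (forall w, inr w \in e -> w \in W) ->
     incore e \in forcing_triples :|: forced_triples /\ c (incore e) = b) ->
  exists Q, mono_clique t (forcing_triples :|: forced_triples) c b Q.
Proof.
move=> cW Wb We; pose Q0 : {set core} := apexes :|: inr @: W.
exists (incore Q0); split.
  rewrite card_incore cardsU card_imset; last by move=> x y [].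
  rewrite cW cards2 (_ : _ :&: _ = set0) ?cards0 ?subn0.
    by rewrite subnKC // ltnW // ltnW.
  apply/eqP/set0Pn=> -[v]; rewrite inE => /andP[va /imsetP[x _ vE]].
  by move: va; rewrite vE !inE.
move=> g gQ cg.
have [e gE] : exists e, g = incore e.
  exists [set x | inl x \in g]; apply/setP=> -[x|q]; first by rewrite mem_incore inE.
  apply/idP/idP => [/(subsetP gQ)|] /imsetP[] //.
rewrite gE card_incore in cg; rewrite gE incore_sub in gQ; rewrite {g}gE.
have inW w : inr w \in e -> w \in W.
  by move/(subsetP gQ); rewrite !inE /= mem_imset // => x y [].
have [ae|ae] := boolP (apexes \subset e); last exact: We.
have [w eE] := apexes_card ae cg; split.
  apply/setUP; right; apply: imset_f; apply/setUP; right.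
  by rewrite eE; apply: imset_f.
by rewrite eE Wb // inW // eE !inE eqxx.
Qed.

Lemma forcing (c : {set gadget} -> bool) b :
  (forall g, g \in forcing_triples -> c g = b) ->
  exists b' Q, mono_clique t (forcing_triples :|: forced_triples) c b' Q.
Proof.
move=> cb.
(* A transversal triple of colour [b] completes its petal clique, whose other triples are
   forcing. *)
have [[e eP ce]|nP] := classic (exists2 e, e \in transversal_triples & c (incore e) = b).
  have [e3 _ _] := transversal_triplesP eP.
  exists b, (petal_clique e); split; first exact: card_petal_clique.
  move=> g ge cg; have [->|gne] := eqVneq g (incore e).
    split=> //; apply/setUP; right; apply: imset_f; apply/setUP; left.
    exact: eP.
  by have gF := forcing_petal eP ge cg gne; rewrite inE gF cb.
have tb e : e \in transversal_triples -> c (incore e) = ~~ b.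
  move=> eP; case E: (c _) (b) nP => -[] nP //; case: nP; exists e => //.
have [[i iP]|nrow] :=
    classic (exists i, forall j, c (incore (apex_triple (i, j))) = b).
  exists b; apply: (@spanned_clique c b [set w | w.1 == i]).
  - have -> : [set w : 'I_(t - 2) * 'I_(t - 2) | w.1 == i] =
        (fun j => (i, j)) @: setT.
      apply/setP=> -[i' j]; rewrite inE /=; apply/eqP/imsetP => [->|[j' _ [->]]] //.
      by exists j.
    by rewrite card_imset ?cardsT ?card_ord // => j j' [].
  - by move=> [i' j]; rewrite inE /= => /eqP->; apply: iP.
  - move=> e ce ae eW; have eF : incore e \in forcing_triples.
      apply/setUP; left; apply: imset_f; rewrite inE ce ae /=.
      apply/forallP=> x; apply/forallP=> y; apply/implyP=> /eW xi.
      apply/implyP=> /eW; move: xi; rewrite !inE => /eqP-> /eqP->.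
      exact: eqxx.
    by rewrite inE eF cb.
have hP i : exists j, c (incore (apex_triple (i, j))) == ~~ b.
  have [j jP] := not_all_ex_not _ _ (not_ex_all_not _ _ nrow i).
  by exists j; case: (c _) (b) jP => -[] // [].
(* No row is entirely of colour [b], so [h] selects in each row a point whose apex triple has the
   other colour. *)
pose h i := xchoose (hP i).
exists (~~ b); apply: (@spanned_clique c (~~ b) [set (i, h i) | i in setT]).
- by rewrite card_imset ?cardsT ?card_ord // => i j [].
- by move=> _ /imsetP[i _ ->]; apply/eqP/(xchooseP (hP i)).
- move=> e ce ae eW; have eP : e \in transversal_triples.
    rewrite inE ce ae /=.
    apply/forallP=> x; apply/forallP=> y; apply/implyP=> /eW/imsetP[i _ ->].
    apply/implyP=> /eW/imsetP[j _ ->] /=; apply/implyP.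
    by apply: contraNneq => ->.
  split; last exact: tb.
  by apply/setUP; right; apply: imset_f; apply/setUP; left.
Qed.

Lemma forced_codegree :
  #|[set x in forced_triples | incore apexes \subset x]| <= (t - 2) ^ 2.
Proof.
have -> : (t - 2) ^ 2 = #|[set: 'I_(t - 2) * 'I_(t - 2)]|.
  by rewrite cardsT card_prod !card_ord mulnn.
apply: leq_trans (leq_imset_card (fun w => incore (apex_triple w)) _).
apply: subset_leq_card; apply/subsetP=> x.
rewrite inE => /andP[/imsetP[e eX ->]]; rewrite incore_sub => ae.
case/setUP: eX => [/transversal_triplesP[_ /negP//]|/apex_triplesP[w ->]].
exact: imset_f.
Qed.

End Gadget.

(** * Assembling the copies *)

Lemma imset_preimset (U V : finType) (f : U -> V) (g : {set V}) (A : {set U}) :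
  g \subset f @: A -> f @: (f @^-1: g) = g.
Proof.
move=> gA; apply/setP=> y; apply/imsetP/idP => [[x]|yg]; first by rewrite inE => ? ->.
by have /imsetP[x _ yx] := subsetP gA y yg; exists x; rewrite // inE -yx.
Qed.

Lemma preimset_imset (U V : finType) (f : U -> V) (A : {set U}) :
  injective f -> f @^-1: (f @: A) = A.
Proof. by move=> f_inj; apply/setP=> x; rewrite inE mem_imset. Qed.

Lemma clique_pair_covered (T : finType) (E : {set {set T}}) (Q : {set T}) :
  2 < #|Q| -> (forall g : {set T}, g \subset Q -> #|g| = 3 -> g \in E) ->
  {in Q &, forall x y, x != y -> covered E [set x; y]}.
Proof.
move=> cQ QE x y xQ yQ xy; have [z [zQ zx zy]] := exists_third x y cQ.
apply/coveredP; exists [set x; y; z]; last exact: subsetUl.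
by apply: QE; rewrite ?triple_sub ?card_triple.
Qed.

Section FromCopies.

Variables (t : nat) (W : finType) (EW : {set {set W}})
  (FW : {set {ffun gadget t -> W}}) (V : finType) (p : V -> W)
  (E : {set {set V}}) (F : {set {ffun gadget t -> V}}).
Hypothesis t_gt3 : 3 < t.
Hypothesis ramW : ramsey_family (forcing_triples t) EW FW.
Hypothesis st :
  partite_stage (forcing_triples t) (forced_triples t) EW FW EW p E F.
Hypothesis apexes_apart : forall f : {ffun gadget t -> W}, f \in FW ->
  ~~ covered EW (f @: incore (apexes t)).

Let EE := E :|: extras (forced_triples t) F.

Let ramV : ramsey_family (forcing_triples t) E F := partite_ramsey ramW st.

Let f_inj (f : {ffun gadget t -> V}) : f \in F -> injective f.
Proof. by case: ramV => _ copies _ /copies[]. Qed.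

Lemma card_copies_edge e : e \in EE -> #|e| = 3.
Proof.
have [cE _ _] := ramV; case/setUP=> [/cE//|/extrasP[f [x [fF xX ->]]]].
by rewrite card_imset ?(forced_card xX) //; apply: f_inj.
Qed.

Let pull_forcing (f : {ffun gadget t -> V}) (g : {set gadget t}) :
  f \in F -> #|g| = 3 -> f @: g \in E -> g \in forcing_triples t.
Proof.
move=> fF cg gE; apply: forcing_induced cg _ => /=.
by apply: (stage_induced st fF); apply/coveredP; exists (f @: g).
Qed.

Let pull_forced (f f' : {ffun gadget t -> V}) (g x : {set gadget t}) :
  f \in F -> f' \in F -> x \in forced_triples t -> f @: g = f' @: x -> g = x.
Proof.
move=> fF f'F xX gx; have [//|[_ cx]] := stage_coherent st fF f'F gx.
by rewrite (negPf (forced_not_covered xX)) in cx.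
Qed.

Let pull (f : {ffun gadget t -> V}) (g : {set gadget t}) :
  f \in F -> #|g| = 3 -> f @: g \in EE ->
  g \in forcing_triples t :|: forced_triples t.
Proof.
move=> fF cg /setUP[/(pull_forcing fF cg) gF|/extrasP[f' [x [f'F xX gx]]]].
  by rewrite inE gF.
by rewrite (pull_forced fF f'F xX gx) inE xX orbT.
Qed.

(** In a copy with monochromatic forcing triples, [forcing] yields a clique among the triples of
    that copy. *)
Lemma copies_arrow : arrow t EE.
Proof.
move=> c; have [_ copies ram] := ramV; have [f fF [b fb]] := ram c.
have [b' [Q [cQ QP]]] := forcing t_gt3 (c := fun g => c (f @: g)) fb.
have [finj fE] := copies f fF.
exists b', (f @: Q); split; first by rewrite card_imset.
move=> g gQ cg; rewrite -(imset_preimset gQ).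
have [||gX cg'] := QP (f @^-1: g).
- apply/subsetP=> x; rewrite inE => /(subsetP gQ).
  by rewrite mem_imset.
- by rewrite -(card_imset _ finj) (imset_preimset gQ).
split=> //; case/setUP: gX => [/fE|] gX; apply/setUP; [by left|right].
by apply/extrasP; exists f, (f @^-1: g).
Qed.

(** Colour the triples by membership in [E]. A monochromatic clique lies in one copy and is neither
    entirely forcing nor entirely transversal, so it contains the apex triple of some copy. The pair
    [S] of apexes of that copy is the required pair. *)
Lemma copies_pair (E' : {set {set V}}) : E' \subset EE -> arrow t E' ->
  exists S : {set V}, [/\ #|S| = 2, 0 < #|[set e in E' | S \subset e]| &
    #|[set e in E' | S \subset e]| <= (t - 2) ^ 2].
Proof.
move=> sE arr; have [b [Q [cQ QP]]] := arr (fun g => g \in E).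
have [[f [w [fF gQ]]]|noapex] := classic (exists (f : {ffun gadget t -> V}) w,
    f \in F /\ f @: incore (apex_triple w) \subset Q).
  pose S := f @: incore (apexes t).
  have SE : S = [set f (inl (inl true)); f (inl (inl false))].
    by rewrite /S /incore /apexes !imsetU1 !imset_set1.
  have finj := f_inj fF.
  exists S; split.
  - by rewrite card_imset // card_incore cards2.
  - apply/card_gt0P; exists (f @: incore (apex_triple w)); rewrite inE.
    have [|-> _] := QP _ gQ; first by rewrite card_imset // card_incore apex_triple_card.
    by rewrite imsetS // incore_sub subsetUr.
  apply: leq_trans (forced_codegree t).
  rewrite -(card_imset _ (imset_inj finj)).
  apply: subset_leq_card; apply/subsetP=> e; rewrite inE => /andP[eE' Se].
  have /setUP[eE|/extrasP[f' [x [f'F xX eE]]]] := subsetP sE e eE'.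
    have : covered E S by apply/coveredP; exists e.
    by move/(stage_induced st fF); rewrite (negPf (apexes_not_covered t)).
  have f'inj := f_inj f'F.
  have SA : f @: incore (apexes t) = f' @: (f' @^-1: S).
    by rewrite (imset_preimset (A := x)) // -eE.
  have Ax : f' @^-1: S \subset x.
    by rewrite -(preimset_imset x f'inj) -eE preimsetS.
  have [SA'|[cS _]] := stage_coherent st fF f'F SA; last first.
    by rewrite (negPf (apexes_not_covered t)) in cS.
  (* The apex pair is uncovered in [EW], so it determines the copy, and the edges of [E'] through
     [S] are forced triples of [f] alone. *)
  have ff' : f = f'.
    apply: (stage_determined st fF f'F (u := inl (inl true)) (v := inl (inl false))).
      have := apexes_apart (stage_copy st fF).
      by rewrite /incore /apexes !imsetU1 !imset_set1 !ffunE.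
    by move: SA; rewrite -SA' /incore /apexes !imsetU1 !imset_set1.
  apply/imsetP; exists x; last by rewrite ff' -eE.
  by rewrite inE xX SA'.
exfalso.
have Q3 : 2 < #|Q| by rewrite cQ ltnW.
have [f fF Qf] : exists2 f : {ffun gadget t -> V}, f \in F & Q \subset f @: setT.
  apply: (stage_local st); first by rewrite cQ.
  apply: clique_pair_covered => // g gQ cg.
  by apply: (subsetP sE); have [] := QP g gQ cg.
have finj := f_inj fF.
have QE := imset_preimset Qf.
have cQ0 : #|f @^-1: Q| = t by rewrite -(card_imset _ finj) QE.
have Q0P (g : {set gadget t}) : g \subset f @^-1: Q -> #|g| = 3 ->
    f @: g \in E' /\ (f @: g \in E) = b.
  move=> gQ cg; apply: QP; last by rewrite card_imset.
  by rewrite -QE imsetS.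
case: b QP Q0P => QP Q0P.
  apply: (no_forcing_clique t_gt3 _ cQ0) => g gQ cg.
  by have [_] := Q0P g gQ cg; apply: pull_forcing.
apply: (no_transversal_clique t_gt3 _ cQ0) => g gQ cg.
have [gE' gnE] := Q0P g gQ cg.
have := subsetP sE _ gE'; rewrite inE gnE => /extrasP[f' [x [f'F xX gx]]].
have gE := pull_forced fF f'F xX gx; rewrite -gE in xX.
case/imsetP: xX => e + gE2; rewrite gE2 => /setUP[eP|/apex_triplesP[w eE]].
  exact: imset_f.
case: noapex; exists f, w; split=> //.
by rewrite -eE -gE2 -QE imsetS.
Qed.

(** If all pairs in [U] were covered, [U] would lie in a single copy. The colouring from
    [gadget_not_ramsey], transported to that copy, would then leave no monochromatic clique. *)
Lemma copies_uncovered_pair (E' : {set {set V}}) (U : {set V}) :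
  E' \subset EE -> arrow t E' -> (forall e, e \in E' -> e \subset U) ->
  exists x y, [/\ x \in U, y \in U, x != y & ~~ covered E' [set x; y]].
Proof.
move=> sE arr EU; apply: NNPP => nex.
have covU : {in U &, forall x y, x != y -> covered EE [set x; y]}.
  move=> x y xU yU xy; case cov : (covered EE [set x; y]) => //; case: nex.
  exists x, y; split=> //; apply: contraFN cov => /coveredP[e eE' xye].
  by apply/coveredP; exists e => //; apply: (subsetP sE).
have QU b c Q : mono_clique t E' c b Q -> Q \subset U.
  move=> [cQ QP]; apply/subsetP=> x xQ.
  have Q3 : 2 < #|Q| by rewrite cQ ltnW.
  have [y [yQ yx _]] := exists_third x x Q3.
  have [z [zQ zx zy]] := exists_third x y Q3.
  rewrite eq_sym in yx.
  have [gE _] := QP _ (triple_sub xQ yQ zQ) (card_triple yx zx zy).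
  by apply: (subsetP (EU _ gE)); rewrite !inE eqxx.
have cU : 3 < #|U|.
  have [b [Q Qc]] := arr (fun=> true); apply: leq_trans (subset_leq_card (QU _ _ _ Qc)).
  by case: Qc => ->.
have [f fF Uf] := stage_local st cU covU.
have finj := f_inj fF.
have [cJ cJP] := gadget_not_ramsey t_gt3.
have [b [Q Qc]] := arr (fun g => cJ (f @^-1: g)).
have Qf := subset_trans (QU _ _ _ Qc) Uf; have [cQ QP] := Qc.
have QE := imset_preimset Qf.
apply: (cJP b (f @^-1: Q)); split; first by rewrite -(card_imset _ finj) QE.
move=> g gQ cg; have [||gE'] := QP (f @: g).
- by rewrite -QE imsetS.
- by rewrite card_imset.
rewrite preimset_imset // => ->; split=> //.
by apply: pull fF cg _; apply: (subsetP sE).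
Qed.

End FromCopies.

(** The last two clauses range over all Ramsey subfamilies [E'], so that they survive the passage to
    a minimal Ramsey subhypergraph, which is not explicit. There [U] becomes its vertex set. *)
Lemma ramsey_with_small_codegree (t : nat) : 3 < t ->
  exists (V : finType) (E : {set {set V}}), [/\ forall e, e \in E -> #|e| = 3,
    arrow t E,
    forall E' : {set {set V}}, E' \subset E -> arrow t E' ->
      exists S : {set V}, [/\ #|S| = 2, 0 < #|[set e in E' | S \subset e]| &
        #|[set e in E' | S \subset e]| <= (t - 2) ^ 2] &
    forall (E' : {set {set V}}) (U : {set V}), E' \subset E -> arrow t E' ->
      (forall e, e \in E' -> e \subset U) ->
      exists x y, [/\ x \in U, y \in U, x != y & ~~ covered E' [set x; y]]].
Proof.
move=> t_gt3; have J_gt0 := forcing_nonempty t_gt3.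
have [N [F0 ram0]] := complete_ramsey_family (@forcing_card t).
have [V1 [p1 [E1 [F1 st1]]]] := partite_construction (forced_triples t) J_gt0 ram0.
have ram1 := partite_ramsey ram0 st1.
have [V [p [E [F st]]]] := partite_construction (forced_triples t) J_gt0 ram1.
(* The copies of the first construction are induced, so their apexes are uncovered in [E1]. This is
   what makes [stage_determined] applicable to the apexes after the second construction. *)
have apart (f : {ffun gadget t -> V1}) : f \in F1 ->
    ~~ covered E1 (f @: incore (apexes t)).
  move=> fF; apply/negP=> /(stage_induced st1 fF).
  by rewrite (negPf (apexes_not_covered t)).
exists V, (E :|: extras (forced_triples t) F); split.
- exact: card_copies_edge ram1 st.
- exact: copies_arrow t_gt3 ram1 st.
- exact: copies_pair t_gt3 ram1 st apart.
- exact: copies_uncovered_pair t_gt3 ram1 st.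
Qed.

Lemma minimal_pair_codegree (t : nat) (T : finType) (G : hypergraph3 T) (S : {set T}) :
  3 < t -> minimal_ramsey 2 (complete3 t) G -> #|S| = 2 -> 0 < codegree G S ->
  (t - 2) ^ 2 <= codegree G S.
Proof.
move=> t_gt3 [ramG minG] cS; rewrite /codegree => S_pos.
have t_gt2 := ltnW t_gt3.
apply: pair_codegree_lower_bound => //; first exact/(ramseyP _ t_gt2).
have P : [forall e in [set e in edges G | ~~ (S \subset e)],
    (e \subset verts G) && (#|e| == 3)].
  apply/forall_inP=> e; rewrite inE => /andP[eG _].
  by have /forall_inP/(_ e eG) := edgesP G.
move=> arr; apply: (minG (Hypergraph3 P)); last exact/(ramseyP _ t_gt2).
split.
  by rewrite /subhypergraph subxx; apply/subsetP=> e; rewrite inE => /andP[].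
case/card_gt0P: S_pos => e; rewrite inE => /andP[eG Se] GG.
by move: eG; rewrite -GG /= inE Se andbF.
Qed.

Lemma minimal_with_small_codegree (t : nat) : 3 < t ->
  exists (T : finType) (G : hypergraph3 T), [/\ minimal_ramsey 2 (complete3 t) G,
    is_delta2 G 0 & is_pos_delta2 G ((t - 2) ^ 2)].
Proof.
move=> t_gt3; have t_gt2 := ltnW t_gt3.
have [V [E [cE arrE pairE uncovE]]] := ramsey_with_small_codegree t_gt3.
have P : [forall e in E, (e \subset [set: V]) && (#|e| == 3)].
  by apply/forall_inP=> e /cE->; rewrite subsetT.
have [|G /andP[_ GE] minG] := @minimal_ramsey_sub 2 _ _ (complete3 t) (Hypergraph3 P).
  exact/(ramseyP _ t_gt2).
have arrG : arrow t (edges G) by apply/(ramseyP _ t_gt2); case: minG.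
have Gverts e : e \in edges G -> e \subset verts G.
  by move=> eG; have /forall_inP/(_ e eG)/andP[] := edgesP G.
exists V, G; split=> //.
  split=> //; have [x [y [xG yG xy ncov]]] := uncovE _ _ GE arrG Gverts.
  exists [set x; y]; split; first by rewrite subUset !sub1set xG.
    by rewrite cards2 xy.
  apply/eqP; rewrite cards_eq0; apply/set0Pn=> -[e]; rewrite inE => /andP[eG xye].
  by case/negP: ncov; apply/coveredP; exists e.
have [S [cS S_pos S_le]] := pairE _ GE arrG.
split=> [|k [S' [_ cS' S'_pos <-]]]; last exact: minimal_pair_codegree.
exists S; split=> //.
  case/card_gt0P: S_pos => e; rewrite inE => /andP[eG Se].
  exact: subset_trans Se (Gverts e eG).
by apply/eqP; rewrite eqn_leq S_le minimal_pair_codegree.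
Qed.

Theorem theorem1p2 (t : nat) (ht : 4 <= t) :
  is_s22 t 0 /\ is_s22' t ((t - 2) ^ 2).
Proof.
have [T [G [minG G0 Gs]]] := minimal_with_small_codegree ht.
split; split=> //; [by exists T, G|by exists T, G|].
move=> k [T' [G' [minG' [[S [_ cS S_pos <-]] _]]]].
exact: minimal_pair_codegree.
Qed.
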